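(* Let $\lambda\in\mathcal P_{r,n}$, let $T\in NST(\lambda)$ be a natural standard $r$-tableau of shape $\lambda$, and let $e_T$ be the associated primitive idempotent of $\mathbb C[S_{n_1}\times\cdots\times S_{n_r}]$. Then: (1) $e_T\mathcal O_U$ is a nontrivial (i.e. nonzero) $\mathcal D_V$-submodule of $\mathcal O_U$; (2) the $\mathcal D_V$-module $e_T\mathcal O_U$ is simple; (3) there exist $S\in ST(\lambda)$ and a higher Specht polynomial $F_T^S$ for $(T,S)$ such that $e_T\mathcal O_U=\mathcal D_V F_T^S$.
   Context: Setting. Let $n_1,\dots,n_r$ be positive integers, $n=\sum_i n_i$, $m_i=n_1+\cdots+n_{i-1}$ (so $m_1=0$), and $B_i=\{m_i+1,\dots,m_i+n_i\}$. The group $S_{n_1}\times\cdots\times S_{n_r}\subset S_n$ (the $i$-th factor permuting $B_i$) acts on $\mathcal O_X=\mathbb C[x_1,\dots,x_n]$ by $(\sigma f)(x_1,\dots,x_n)=f(x_{\sigma(1)},\dots,x_{\sigma(n)})$. Write $\mathcal O_Y=\mathcal O_X^{S_{n_1}\times\cdots\times S_{n_r}}=\mathbb C[y_1,\dots,y_n]$, where the $y_j$ with $j\in B_i$ are algebraically independent generators (e.g. the elementary symmetric polynomials) of $\mathbb C[x_j: j\in B_i]^{S_{n_i}}$. Put $\Delta_i=\prod_{k<l,\ k,l\in B_i}(x_k-x_l)$, $\Delta=\prod_i\Delta_i$, $\mathcal O_U=\mathbb C[x_1,\dots,x_n,\Delta^{-1}]$, $\mathcal O_V=\mathbb C[y_1,\dots,y_n,\Delta^{-2}]$,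 and $\mathcal D_V=\mathbb C\langle y_1,\dots,y_n,\partial/\partial y_1,\dots,\partial/\partial y_n,\Delta^{-2}\rangle$ (the localized Weyl algebra). $\mathcal O_U$ is a left $\mathcal D_V$-module: $\mathcal O_V$ acts by multiplication and $\partial/\partial y_j$ acts by the unique extension of this derivation of $\mathcal O_V$ to $\mathcal O_U$ (which is finite étale over $\mathcal O_V$). Tableaux. An $r$-diagram of type $(n_1,\dots,n_r)$ is an $r$-tuple $\lambda=(\lambda^1,\dots,\lambda^r)$ of partitions (Young diagrams) with $\lambda^i\vdash n_i$; its size is $n$. $\mathcal P_{r,n}$ is the set of $r$-diagrams of type $(n_1,\dots,n_r)$. An $r$-tableau of shape $\lambda$ is a tuple $T=(T^1,\dots,T^r)$ of fillings of the $\lambda^i$; it is standard if each of $1,\dots,n$ appears exactly once and every row and column of each $T^i$ is strictly increasing; it is natural if moreover the set of entries of $T^i$ is $B_i$ for each $i$. $ST(\lambda)$ and $NST(\lambda)$ are the sets of standard, respectively natural standard, $r$-tableaux of shape $\lambda$. Young symmetrizers. $e_{T^i}=\frac{f^{\lambda^i}}{n_i!}\sum_{\sigma\in R(T^i),\ \tau\in C(T^i)}\operatorname{sgn}(\tau)\,\tau\sigma$, where $R(T^i)$, $C(T^i)$ are the row and column stabilizers and $f^{\lambda^i}$ is the number of standard tableaux of shape $\lambda^i$; $e_T=e_{T^1}\cdots e_{T^r}$. Higher Specht polynomials. The word $w(S)$ of $S\in ST(\lambda)$ is obtained by reading the columns of $S^1$ from bottom to top, starting from the left, then those of $S^2$,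 and so on. The number $1$ has index $0$; if $k$ has index $p$, then $k+1$ has index $p$ if it lies to the right of $k$ in $w(S)$ and $p+1$ if it lies to the left. Replacing each entry of $S$ by its index gives the index tableau $i(S)$. For $T,S$ of shape $\lambda$, $x_T^{i(S)}=\prod_b x_{T(b)}^{i(S)(b)}$, product over all boxes $b$ of $\lambda$, and $F_T^S=e_T(x_T^{i(S)})$. *)

(* Defs.v *)
From HB Require Import structures.
From mathcomp Require Import all_boot all_order all_fingroup all_algebra.
From mathcomp Require Import reals complex.
From mathcomp Require Import mpoly.

Set Implicit Arguments.
Unset Strict Implicit.
Unset Printing Implicit Defensive.

Import GRing.Theory.
Local Open Scope ring_scope.

(* Entries, variables and block elements are numbered from 0, so that
   {1, ..., n} becomes 'I_n. *)

Definition is_partition (k : nat) (sh : seq nat) : bool :=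
  [&& sorted geq sh, 0%N \notin sh & sumn sh == k].

Definition box (sh : seq nat) : finType :=
  {i : 'I_(size sh) & 'I_(nth 0%N sh i)}.

Definition brow (sh : seq nat) (b : box sh) : nat := tag b.
Definition bcol (sh : seq nat) (b : box sh) : nat := tagged b.

Definition increasing (sh : seq nat) (n : nat) (t : box sh -> 'I_n) : bool :=
  [forall b, forall b',
     ((brow b == brow b') && (bcol b < bcol b')%N ==> (t b < t b')%N)
  && ((bcol b == bcol b') && (brow b < brow b')%N ==> (t b < t b')%N)].

(* f^sh *)
Definition nb_std (sh : seq nat) : nat :=
  #|[set t : {ffun box sh -> 'I_(sumn sh)} |
      [forall k, #|[set b | t b == k]| == 1%N] && increasing t]|.

Local Notation "p %:F" := (@FracField.tofrac _ p).

(* A ring endomorphism of A, extended to the fractions. *)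
Definition frac_map (A : idomainType) (f : A -> A) (u : {fraction A}) :
    {fraction A} :=
  let x := generic_quotient.repr u in (f \n_x)%:F / (f \d_x)%:F.

Lemma frac_repr (A : idomainType) (u : {fraction A}) :
  let x := generic_quotient.repr u in u = (\n_x)%:F / (\d_x)%:F.
Proof.
move=> x; have dx : \d_x != 0 := denom_ratioP x.
apply: (canRL (mulfK _)); first by rewrite tofrac_eq0.
rewrite -[u in LHS]generic_quotient.reprK -/x; unlock FracField.tofrac.
rewrite -[LHS]FracField.pi_mul; apply/generic_quotient.eqmodP.
rewrite /= FracField.equivfE /FracField.mulf.
by rewrite !numden_Ratio ?mulr1 ?oner_neq0 // mulrC.
Qed.

Lemma frac_eq (A : idomainType) (p q a b : A) : q != 0 -> b != 0 ->
  (p%:F / q%:F == a%:F / b%:F) = (p * b == a * q).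
Proof. by move=> q0 b0; rewrite eqr_div ?tofrac_eq0 // -!rmorphM tofrac_eq. Qed.

Lemma frac_mapE (A : idomainType) (f : {rmorphism A -> A}) (p q : A) :
  injective f -> q != 0 -> frac_map f (p%:F / q%:F) = (f p)%:F / (f q)%:F.
Proof.
move=> f_inj q0; rewrite /frac_map.
have f0 a : (f a == 0) = (a == 0) by rewrite -[RHS](inj_eq f_inj) rmorph0.
have := frac_repr (p%:F / q%:F).
move: (generic_quotient.repr _) => x /= /eqP.
have dx : \d_x != 0 := denom_ratioP x.
rewrite frac_eq // => /eqP pq; apply/eqP.
by rewrite frac_eq ?f0 // -!rmorphM pq.
Qed.

Section Blocks.

Variables (r : nat) (d : 'I_r -> nat).

Definition nvars : nat := (\sum_(i < r) d i)%N.

Definition offset (i : 'I_r) : nat := (\sum_(j < r | (j < i)%N) d j)%N.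

Definition block (i : 'I_r) : {set 'I_nvars} :=
  [set k : 'I_nvars | (offset i <= k < offset i + d i)%N].

Definition is_rdiagram (la : 'I_r -> seq nat) : Prop :=
  forall i, is_partition (d i) (la i).

Definition rbox (la : 'I_r -> seq nat) : finType := {i : 'I_r & box (la i)}.

Definition rtableau (la : 'I_r -> seq nat) : Type :=
  forall i : 'I_r, box (la i) -> 'I_nvars.

Section Tableaux.

Variable la : 'I_r -> seq nat.

Definition entry (T : rtableau la) (b : rbox la) : 'I_nvars :=
  T (tag b) (tagged b).

Definition is_standard (T : rtableau la) : Prop :=
  (forall k, #|[set b | entry T b == k]| = 1%N) /\
  (forall i, increasing (T i)).

Definition is_natural (T : rtableau la) : Prop :=
  is_standard T /\ forall i, [set T i b | b : box (la i)] = block i.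

(* Columns from left to right, each one from bottom to top, and the components
   of the r-diagram in order. *)
Definition reading_le : rel (rbox la) := fun b b' =>
  [|| (tag b < tag b')%N
    , (tag b == tag b') && (bcol (tagged b) < bcol (tagged b'))%N
    | [&& tag b == tag b', bcol (tagged b) == bcol (tagged b')
        & (brow (tagged b') <= brow (tagged b))%N]].

Definition word (S : rtableau la) : seq nat :=
  [seq nat_of_ord (entry S b) | b <- sort reading_le (enum (rbox la))].

End Tableaux.

Fixpoint windex (w : seq nat) (k : nat) : nat :=
  match k with
  | 0 => 0
  | k'.+1 => if (index k' w < index k'.+1 w)%N then windex w k'
             else (windex w k').+1
  end.

Definition index_tableau la (S : rtableau la) (b : rbox la) : nat :=
  windex (word S) (entry S b).

Section Algebra.

Variable R : realType.

Local Notation n := nvars.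
Local Notation C := (R[i]).
Local Notation OX := {mpoly C[n]}.
Local Notation K := {fraction OX}.

Definition Delta : OX :=
  \prod_(i < r) \prod_(k in block i) \prod_(l in block i | (k < l)%N)
    ('X_k - 'X_l).

(* O_U is realised inside C(x_1, ..., x_n). *)
Definition OU (u : K) : Prop :=
  exists (p : OX) (m : nat), u = p%:F / Delta%:F ^+ m.

Definition only_in (B : {set 'I_n}) (p : OX) : Prop :=
  forall m, m \in msupp p -> forall k, k \notin B -> m k = 0%N.

(* C[x_j : j in B_i]^{S_(n_i)}; msym s substitutes 'X_(s k) for 'X_k. *)
Definition block_invariant (i : 'I_r) (p : OX) : Prop :=
  only_in (block i) p /\
  forall s : 'S_n, perm_on (block i) s -> msym s p = p.

Definition subst_y (y : 'I_n -> OX) (p : OX) : OX :=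
  p \mPo [tuple y j | j < n].

Definition is_coord_system (y : 'I_n -> OX) : Prop :=
  forall i : 'I_r,
  [/\ forall j, j \in block i -> block_invariant i (y j),
      forall p, block_invariant i p ->
        exists2 q, only_in (block i) q & p = subst_y y q
    & forall q, only_in (block i) q -> subst_y y q = 0 -> q = 0].

(* D restricts to a derivation of O_U which extends d/dy_j; the values of D
   outside O_U are irrelevant. The requirement on C[y_1, ..., y_n] determines
   D on its localisation O_V, and hence on O_U. *)
Definition extends_dy (y : 'I_n -> OX) (j : 'I_n) (D : K -> K) : Prop :=
  [/\ forall u, OU u -> OU (D u),
      forall u v, OU u -> OU v -> D (u + v) = D u + D v,
      forall u v, OU u -> OU v -> D (u * v) = D u * v + u * D v
    & forall p : OX, D (subst_y y p)%:F = (subst_y y (mderiv j p))%:F].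

(* The localised Weyl algebra C<y, d/dy, Delta^-2> through its action on O_U,
   dy j being the action of d/dy_j. *)
Inductive DV (y : 'I_n -> OX) (dy : 'I_n -> K -> K) : (K -> K) -> Prop :=
| DV_scalar (c : C) : DV y dy (fun u => (c%:MP)%:F * u)
| DV_y (j : 'I_n) : DV y dy (fun u => (y j)%:F * u)
| DV_dy (j : 'I_n) : DV y dy (dy j)
| DV_invDelta2 : DV y dy (fun u => (Delta%:F ^+ 2)^-1 * u)
| DV_add P Q : DV y dy P -> DV y dy Q -> DV y dy (fun u => P u + Q u)
| DV_mul P Q : DV y dy P -> DV y dy Q -> DV y dy (fun u => P (Q u)).

Definition is_submodule y dy (M : K -> Prop) : Prop :=
  [/\ forall u, M u -> OU u,
      M 0,
      forall u v, M u -> M v -> M (u + v)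
    & forall P u, DV y dy P -> M u -> M (P u)].

Definition nonzero (M : K -> Prop) : Prop := exists2 u, M u & u != 0.

Definition is_simple y dy (M : K -> Prop) : Prop :=
  [/\ is_submodule y dy M,
      nonzero M
    & forall N : K -> Prop, is_submodule y dy N ->
        (forall u, N u -> M u) ->
        (forall u, N u -> u = 0) \/ (forall u, N u <-> M u)].

Definition cyclic_submodule y dy (f : K) (u : K) : Prop :=
  exists2 P, DV y dy P & u = P f.

Definition sact (s : 'S_n) : K -> K := frac_map (msym s).

Lemma msym_inj (s : 'S_n) : injective (@msym n C s).
Proof.
apply: (can_inj (g := msym s^-1%g)) => p.
rewrite -msymMm mulgV; apply/mpolyP => m; rewrite mcoeff_sym.
by congr (mcoeff _ p); apply/mnmP => i; rewrite mnmE perm1.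
Qed.

Lemma sactE (s : 'S_n) (p q : OX) :
  q != 0 -> sact s (p%:F / q%:F) = (msym s p)%:F / (msym s q)%:F.
Proof. exact: (frac_mapE (f := msym s) p (@msym_inj s)). Qed.

Definition row_stab (sh : seq nat) (t : box sh -> 'I_n) : {set 'S_n} :=
  [set s : 'S_n | perm_on [set t b | b : box sh] s &&
    [forall b, [exists b', (brow b' == brow b) && (s (t b) == t b')]]].

Definition col_stab (sh : seq nat) (t : box sh -> 'I_n) : {set 'S_n} :=
  [set s : 'S_n | perm_on [set t b | b : box sh] s &&
    [forall b, [exists b', (bcol b' == bcol b) && (s (t b) == t b')]]].

(* The action is a left action for the composition of permutations, so that
   tau sigma acts by sigma first; mathcomp's product of permutations composes
   in the opposite order. *)
Definition young1 (sh : seq nat) (t : box sh -> 'I_n) (u : K) : K :=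
  ((nb_std sh)%:R / (sumn sh)`!%:R : C)%:MP%:F *
  \sum_(s in row_stab t) \sum_(c in col_stab t)
    (-1) ^+ odd_perm c * sact c (sact s u).

(* The product e_(T^1) ... e_(T^r), acting on O_U. *)
Definition young la (T : rtableau la) (u : K) : K :=
  foldr (fun i => young1 (T i)) u (enum 'I_r).

Definition image_young la (T : rtableau la) (v : K) : Prop :=
  exists2 u, OU u & v = young T u.

Definition index_monomial la (T S : rtableau la) : OX :=
  \prod_(b : rbox la) 'X_(entry T b) ^+ index_tableau S b.

Definition higher_specht la (T S : rtableau la) : K :=
  young T (index_monomial T S)%:F.

End Algebra.

End Blocks.

Arguments image_young {r d} R {la} T v.
Arguments higher_specht {r d} R {la} T S.

(* Main.v *)
From HB Require Import structures.
Require Import Defs.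
From mathcomp Require Import all_boot all_order all_fingroup all_algebra.
From mathcomp Require boolp.
From mathcomp Require Import reals complex.
From mathcomp Require Import mpoly.
From mathcomp Require Import zify.

Set Implicit Arguments.
Unset Strict Implicit.
Unset Printing Implicit Defensive.

(** Let G be the product of the symmetric groups of the blocks, acting on the
    rational functions by permutation of the variables. For the tableau T let
    a be the sum over the row group and b the signed sum over the column group;
    e_T is a nonzero multiple of c = a b, the operator applying a first
    ([youngE]), so that e_T and c have the same image in O_U.

    The operators of D_V commute with G. Indeed a variable is a simple root of
    the polynomial whose roots are the variables of its block, and the
    coefficients of that polynomial are invariant, so a derivation that kills
    the invariants is zero ([derivation_eq0]). Hence a derivation of O_V has
    only one extension to O_U, which conjugation by G fixes ([dy_act]), and the
    image of c is a submodule.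

    Simplicity combines a fact on the group with a fact on differential
    operators. On the group, a function x such that x (s g t) = sgn(t) x (g) for
    s in the row group and t in the column group is a multiple of the
    coefficients of c ([biequivariant_young_coef]). Applied to c c, this gives
    c c = kappa c, and kappa is not 0 because a multiple of it is a sum of
    squares ([young_scalar_neq0]). On the side of operators, let D_U be the
    algebra generated by O_U and D_V. For v <> 0 and finitely many elements u
    of O_U there is an operator T of D_U such that T v = 1 and every T u is a
    constant ([DU_density]).

    Let N be a submodule of the image of c, v a nonzero element of N, and w any
    element of O_U. Applying b to a v gives kappa v, so a v <> 0. Choose T with
    T (a v) = 1 and T (g v) constant for all g in G. The average over G of the
    operator u |-> (a w) (T u) belongs to D_V ([average_DV]), because the
    invariants of O_U form O_V ([DV_invariant]). It maps v to a combination of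
    the translates of w, whose coefficients form a function x of the above kind
    with x (1) = T (a v) = 1; this combination is therefore c w, and N contains
    the whole image ([young_image_simple]).

    Once the module is simple, any nonzero element generates it. For S take the
    filling of the diagrams row after row: its indices are constant along rows
    and increase from one row to the next of the same diagram. The row group
    then fixes the monomial x_T^i(S), the antisymmetrization b turns it into a
    product of Vandermonde determinants, times a monomial invariant under G, and
    the coefficient of the monomial itself does not vanish
    ([young_monomial_neq0]). *)

Import Order.TTheory GRing.Theory Num.Theory.
Local Open Scope ring_scope.

(** * Permutations preserving a function *)

Section Stabilizers.

Variables (X : finType) (Y : eqType) (q : X -> Y).

Definition stab (B : {set X}) : {set {perm X}} :=
  [set s | perm_on B s && [forall k, q (s k) == q k]].

Lemma stabP (B : {set X}) (s : {perm X}) :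
  reflect (perm_on B s /\ forall k, q (s k) = q k) (s \in stab B).
Proof.
rewrite inE; apply: (iffP andP) => -[sB sq]; split=> //.
  by move=> k; apply/eqP/(forallP sq).
by apply/forallP => k; apply/eqP.
Qed.

Lemma stab_group_set B : group_set (stab B).
Proof.
apply/group_setP; split.
  by apply/stabP; split=> [|k]; [apply: perm_on1 | rewrite perm1].
move=> s t /stabP[sB sq] /stabP[tB tq]; apply/stabP.
by split=> [|k]; [apply: perm_onM | rewrite permM tq sq].
Qed.

Canonical stab_group B := group (stab_group_set B).

Lemma stab_setT (s : {perm X}) :
  (s \in stab [set: X]) = [forall k, q (s k) == q k].
Proof. by rewrite inE (_ : perm_on _ _) //; apply/subsetP => k; rewrite inE. Qed.

(** When the values of q tell A apart, a permutation preserving q and supported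
    in the union restricts to A, so that it factors uniquely. *)
Lemma sum_stabU (V : nmodType) (F : {perm X} -> V) (A B : {set X}) :
    [disjoint A & B] -> (forall k l, q k = q l -> k \in A -> l \in A) ->
  \sum_(s in stab (A :|: B)) F s =
  \sum_(s in stab A) \sum_(t in stab B) F (s * t)%g.
Proof.
move=> dAB qA; rewrite pair_big /=.
rewrite (reindex_onto (fun p : {perm X} * {perm X} => (p.1 * p.2)%g)
  (fun s => (restr_perm A s, ((restr_perm A s)^-1 * s)%g))) /=; last first.
  by move=> s _; rewrite mulKVg.
have nA (s : {perm X}) : (forall k, q (s k) = q k) -> s \in 'N(A | 'P)%g.
  move=> sq; apply/astabsP => k; rewrite /= /aperm.
  by apply/idP/idP; apply: qA; rewrite sq.
have split_stab u : u \in stab (A :|: B) ->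
    restr_perm A u \in stab A /\ ((restr_perm A u)^-1 * u)%g \in stab B.
  move=> /stabP[uAB uq].
  have v1 k : k \in A -> restr_perm A u k = u k by apply: restr_permE; exact: nA.
  have v2 k : k \notin A -> restr_perm A u k = k.
    exact: (out_perm (restr_perm_on A u)).
  have vq k : q (restr_perm A u k) = q k.
    by case: (boolP (k \in A)) => kA; [rewrite v1 | rewrite v2].
  split; apply/stabP; split=> //; first exact: restr_perm_on.
    apply/subsetP => k; rewrite inE; apply: contraR => kB.
    have [kA|kA] := boolP (k \in A).
      pose l := ((restr_perm A u)^-1 k)%g.
      have lA : l \in A.
        by rewrite -(perm_closed l (restr_perm_on A u)) /l permKV.
      by rewrite permM -/l -v1 // /l permKV.
    rewrite permM (_ : ((restr_perm A u)^-1 k)%g = k); last first.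
      by rewrite -{1}(v2 k kA) permK.
    by rewrite (out_perm uAB) // inE (negPf kA).
  move=> k; rewrite permM uq -[in RHS](permKV (restr_perm A u) k).
  by rewrite vq.
apply: eq_bigl => -[s t] /=; apply/andP/andP.
  by case=> /split_stab uS /eqP[e1 e2]; rewrite e2 e1 in uS.
case=> /stabP[sA sq] /stabP[tB tq].
have uq k : q ((s * t)%g k) = q k by rewrite permM tq sq.
have e : restr_perm A (s * t)%g = s.
  apply/permP => k; have [kA|kA] := boolP (k \in A).
    rewrite restr_permE ?nA // permM (out_perm tB) //.
    by rewrite (disjointFr dAB) // (perm_closed _ sA).
  by rewrite (out_perm (restr_perm_on _ _)) // (out_perm sA).
split; last by rewrite e mulKg.
apply/stabP; split=> //; apply: perm_onM.
  exact: subset_trans sA (subsetUl _ _).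
exact: subset_trans tB (subsetUr _ _).
Qed.

End Stabilizers.

(** * The Young symmetrizer in the group algebra *)

Section YoungSymmetrizer.

Variables (X : finType) (I : eqType) (comp : X -> I) (row col : X -> nat).

(* X is the set of entries of an r-tableau: comp k, row k and col k locate the
   box that contains k. The second condition is the shape of a Young diagram:
   columns have no holes. *)
Hypothesis box_inj : forall k l,
  comp k = comp l -> row k = row l -> col k = col l -> k = l.
Hypothesis box_closed : forall k i, (i <= row k)%N ->
  exists l, [/\ comp l = comp k, row l = i & col l = col k].

Local Notation row_group := (stab (fun k => (comp k, row k)) [set: X]).
Local Notation col_group := (stab (fun k => (comp k, col k)) [set: X]).
Local Notation block_group := (stab comp [set: X]).

Lemma row_groupP (s : {perm X}) :
  reflect (forall k, comp (s k) = comp k /\ row (s k) = row k)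
          (s \in row_group).
Proof.
rewrite stab_setT; apply: (iffP forallP) => h k.
  by have /eqP[-> ->] := h k.
by have [-> ->] := h k.
Qed.

Lemma col_groupP (s : {perm X}) :
  reflect (forall k, comp (s k) = comp k /\ col (s k) = col k)
          (s \in col_group).
Proof.
rewrite stab_setT; apply: (iffP forallP) => h k.
  by have /eqP[-> ->] := h k.
by have [-> ->] := h k.
Qed.

Lemma block_groupP (s : {perm X}) :
  reflect (forall k, comp (s k) = comp k) (s \in block_group).
Proof.
by rewrite stab_setT; apply: (iffP forallP) => h k; apply/eqP; rewrite h.
Qed.

Lemma row_sub_block s : s \in row_group -> s \in block_group.
Proof. by move/row_groupP => h; apply/block_groupP => k; case: (h k). Qed.

Lemma col_sub_block s : s \in col_group -> s \in block_group.
Proof. by move/col_groupP => h; apply/block_groupP => k; case: (h k). Qed.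

Lemma row_col_id s : s \in row_group -> s \in col_group -> s = 1%g.
Proof.
move=> /row_groupP rs /col_groupP cs; apply/permP => k; rewrite perm1.
by have [c1 r1] := rs k; have [_ c2] := cs k; apply: box_inj.
Qed.

Lemma tperm_row a b : comp a = comp b -> row a = row b ->
  tperm a b \in row_group.
Proof. by move=> c e; apply/row_groupP => k; case: tpermP => [->|->|]. Qed.

Lemma tperm_col a b : comp a = comp b -> col a = col b ->
  tperm a b \in col_group.
Proof. by move=> c e; apply/col_groupP => k; case: tpermP => [->|->|]. Qed.

Section Functions.

Variable F : numDomainType.

(** The product of permutations composes from left to right, so the row group
    acts on the left. *)
Definition biequivariant (x : {perm X} -> F) : Prop :=
  (forall (s g : {perm X}), s \in row_group -> x (s * g)%g = x g) /\
  (forall (g t : {perm X}), t \in col_group -> x (g * t)%g = (-1) ^+ odd_perm t * x g).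

(** The transposition of a and b on one side compensates that of their images on
    the other, and only the second one changes the sign. *)
Lemma biequivariant_bad_pair x (g : {perm X}) a b : biequivariant x ->
    a != b -> comp a = comp b -> row a = row b ->
    comp (g a) = comp (g b) -> col (g a) = col (g b) ->
  x g = 0.
Proof.
move=> [xr xc] ab cab rab cg colg; apply/eqP; rewrite -eqNr; apply/eqP/esym.
have e : (tperm a b * (g * tperm (g a) (g b)))%g = g.
  apply/permP => k; rewrite !permM.
  by case: (tpermP a b k) => [->|->|/eqP ka /eqP kb];
    rewrite ?tpermL ?tpermR // tpermD // (inj_eq perm_inj) eq_sym.
rewrite -{1}e xr ?tperm_row // xc ?tperm_col // odd_tperm.
by rewrite (inj_eq perm_inj) ab mulN1r.
Qed.

(** When g is followed by column permutations, the rearrangement inequality makes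
    this largest if each column lists its entries in the order of the rows they
    come from. *)
Definition row_weight (g : {perm X}) : nat := (\sum_k row k * row (g k))%N.

Lemma row_weight_swap (g : {perm X}) a b : (row a < row b)%N ->
    (row (g b) < row (g a))%N ->
  (row_weight g < row_weight (g * tperm (g a) (g b))%g)%N.
Proof.
move=> ab gab; have nab : b != a by apply: contraTneq ab => ->; rewrite ltnn.
rewrite /row_weight (bigD1 a) //= (bigD1 b) //=.
rewrite [ltnRHS](bigD1 a) //= [X in (_ < _ + X)%N](bigD1 b) //=.
rewrite !permM tpermL tpermR.
have -> : (\sum_(i | (i != a) && (i != b)) row i * row ((g * tperm (g a) (g b))%g i)
  = \sum_(i | (i != a) && (i != b)) row i * row (g i))%N.
  apply: eq_bigr => i /andP[ia ib].
  by rewrite permM tpermD // (inj_eq perm_inj) eq_sym.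
rewrite !addnA ltn_add2r.
nia.
Qed.

(** In the support of x, take g of largest weight. It sends the entries of a row
    to distinct columns, and no column transposition can increase its weight. By
    induction on the rows this forces g to preserve each of them: if an entry k
    of row i were sent strictly below row i, the box of row i in the column of
    g k would hold the image of an entry below row i, and exchanging both would
    increase the weight. So g is in the row group and x g = x 1. *)
Lemma biequivariant_eq0 x : biequivariant x ->
    (forall g, g \notin block_group -> x g = 0) -> x 1%g = 0 ->
  forall g, x g = 0.
Proof.
move=> xb x_out x1 g0; apply/eqP; apply: contraT => nz0.
pose P g := x g != 0; case: (@arg_maxnP _ g0 P row_weight nz0) => g nz gmax.
have /block_groupP gG : g \in block_group.
  by apply: contraR nz => /x_out ->.
have no_pair a b : comp a = comp b -> row a = row b ->
    col (g a) = col (g b) -> a = b.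
  move=> cab rab gab; apply/eqP; apply: contraR nz => ab.
  by rewrite (biequivariant_bad_pair xb ab cab rab) ?gG.
suff g_row k : row (g k) = row k.
  move: nz; have gR : g \in row_group by apply/row_groupP => k; rewrite gG g_row.
  by have [xr _] := xb; rewrite /P -[g]mulg1 xr // x1 eqxx.
have [i le_ki] := ubnP (row k); elim: i k le_ki => // i IH k; rewrite ltnS leq_eqVlt.
case/orP => [/eqP rk|/IH //].
(* The rows above are already filled by their own entries. *)
have ge_gk : (i <= row (g k))%N.
  rewrite leqNgt; apply/negP => lt_gk.
  pose A := [set a | (comp a == comp k) && (row a == row (g k))].
  have gA : g @: A = A.
    apply/eqP; rewrite eqEcard card_imset ?leqnn ?andbT; last exact: perm_inj.
    apply/subsetP => _ /imsetP[a aA ->]; move: aA.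
    by rewrite !inE => /andP[/eqP ca /eqP ra]; rewrite gG ca IH ?ra ?eqxx.
  have : g k \in g @: A by rewrite gA inE gG !eqxx.
  case/imsetP => a; rewrite inE => /andP[_ /eqP ra] /perm_inj ka.
  by move: lt_gk; rewrite -ra -ka rk ltnn.
apply/eqP; rewrite rk eqn_leq ge_gk andbT leqNgt; apply/negP => gt_gk.
have [l [cl rl kl]] := box_closed ge_gk.
(* The entry b sent to the box of row i in the column of g k. *)
pose b := (g^-1 l)%g; have gb : g b = l by rewrite permKV.
have cb : comp k = comp b by rewrite -(gG b) gb cl gG.
have b_row : row b != i.
  apply/eqP => rb; have kb : k = b by apply: no_pair; rewrite ?gb // rb.
  by move: gt_gk; rewrite kb gb rl ltnn.
have lt_ib : (i < row b)%N.
  rewrite ltn_neqAle eq_sym b_row leqNgt; apply/negP => lt_bi.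
  by have := IH b lt_bi; rewrite gb rl => e; rewrite e ltnn in lt_bi.
have : P (g * tperm (g k) (g b))%g.
  have [_ xc] := xb; rewrite /P xc ?mulf_neq0 ?signr_eq0 //.
  by apply: tperm_col; rewrite ?gb // !gG.
by move/gmax; rewrite /= leqNgt row_weight_swap // ?rk // gb rl.
Qed.

(** The Young symmetrizer as an element of the group algebra, without its
    normalization. *)
Definition young_coef (g : {perm X}) : F :=
  \sum_(s in row_group) \sum_(t in col_group | (s * t == g)%g)
     (-1) ^+ odd_perm t.

Lemma young_coefE (V : pzRingType) (k : {rmorphism F -> V}) (f : {perm X} -> V) :
  \sum_(s in row_group) \sum_(t in col_group) (-1) ^+ odd_perm t * f (s * t)%g
  = \sum_g k (young_coef g) * f g.
Proof.
transitivity (\sum_g \sum_(s in row_group) \sum_(t in col_group)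
    (if (s * t == g)%g then (-1) ^+ odd_perm t else 0) * f g); last first.
  apply: eq_bigr => g _; rewrite /young_coef rmorph_sum [RHS]mulr_suml.
  apply: eq_bigr => s _; rewrite rmorph_sum big_mkcondr -mulr_suml; congr (_ * _).
  by apply: eq_bigr => t _; case: ifP => _; rewrite ?rmorph_sign.
rewrite [RHS]exchange_big; apply: eq_bigr => s _; rewrite [RHS]exchange_big /=.
apply: eq_bigr => t _; rewrite (bigD1 (s * t)%g) //= eqxx big1 ?addr0 //.
by move=> g; rewrite eq_sym => /negPf->; rewrite mul0r.
Qed.

Lemma young_coef_biequivariant : biequivariant young_coef.
Proof.
split=> [s g sR|g t tC].
  rewrite /young_coef (reindex_inj (mulgI s)) /=.
  apply: eq_big => u; first by rewrite groupMl.
  by move=> _; apply: eq_bigl => v; rewrite -mulgA (inj_eq (mulgI s)).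
rewrite /young_coef mulr_sumr; apply: eq_bigr => s _.
rewrite (reindex_inj (mulIg t)) mulr_sumr /=.
apply: eq_big => v; first by rewrite groupMr // mulgA (inj_eq (mulIg t)).
by move=> _; rewrite odd_permM signr_addb mulrC.
Qed.

Lemma young_coef_out g : g \notin block_group -> young_coef g = 0.
Proof.
move=> gG; apply: big1 => s /row_sub_block sG.
by apply: big1 => t /andP[/col_sub_block tG /eqP e]; rewrite -e groupM in gG.
Qed.

Lemma young_coef1 : young_coef 1%g = 1.
Proof.
rewrite /young_coef (bigD1 1%g) ?group1 //= (bigD1 1%g) /=; last first.
  by rewrite group1 mulg1 eqxx.
rewrite odd_perm1 expr0 !big1 ?addr0 // => [s /andP[sR s1]|t].
  apply: big1 => t /andP[tC /eqP st]; case/eqP: s1; apply: row_col_id => //.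
  by rewrite -[s](mulgK t) st mul1g groupV.
by rewrite mul1g => /andP[/andP[_ /eqP->]]; rewrite eqxx.
Qed.

(** Both sides agree at 1, and a biequivariant function is determined by its
    value at 1. *)
Lemma biequivariant_young_coef x : biequivariant x ->
    (forall g, g \notin block_group -> x g = 0) ->
  forall g, x g = x 1%g * young_coef g.
Proof.
move=> [xr xc] x_out g; apply/eqP; rewrite -subr_eq0; apply/eqP.
have [er ec] := young_coef_biequivariant.
apply: (biequivariant_eq0 (x := fun g => x g - x 1%g * young_coef g)).
- split=> [s h sR|h t tC]; first by rewrite xr // er.
  by rewrite xc // ec // mulrBr mulrCA.
- by move=> h hG; rewrite x_out // young_coef_out // mulr0 subr0.
- by rewrite young_coef1 mulr1 subrr.
Qed.

(** The coefficient at 1 of the square of the Young symmetrizer. *)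
Definition young_scalar : F := \sum_h young_coef h * young_coef (h^-1)%g.

Lemma young_coef_sqr g :
  \sum_h young_coef h * young_coef (h^-1 * g)%g = young_scalar * young_coef g.
Proof.
have [er ec] := young_coef_biequivariant.
rewrite (@biequivariant_young_coef
  (fun g => \sum_h young_coef h * young_coef (h^-1 * g)%g)).
- by under eq_bigr do rewrite mulg1.
- split=> [s h sR|h t tC].
    rewrite (reindex_inj (mulgI s)) /=; apply: eq_bigr => u _.
    by rewrite er // invMg -!mulgA mulKg.
  by rewrite mulr_sumr; apply: eq_bigr => u _; rewrite mulgA ec // mulrCA.
move=> h hG; apply: big1 => u _.
have [uG|uG] := boolP (u \in block_group); last by rewrite young_coef_out ?mul0r.
by rewrite [X in _ * X]young_coef_out ?mulr0 // groupMl ?groupV.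
Qed.

Lemma young_coef_real g : young_coef g \is Num.real.
Proof.
by apply: rpred_sum => s _; apply: rpred_sum => t _; rewrite rpredX // rpredN rpred1.
Qed.

(** Write a b for the symmetrizer. The function p below gives the coefficients of
    a b a, which is invariant under inversion; the sum of the squares of these
    coefficients is thus the coefficient at 1 of (a b a) (a b a), a multiple of
    the coefficient of (a b) (a b). It is positive since p takes the value
    #|row_group| at 1. *)
Lemma young_scalar_neq0 : young_scalar != 0.
Proof.
have [er ec] := young_coef_biequivariant.
pose p (g : {perm X}) := \sum_(s in row_group) young_coef (g * s)%g.
have pE : \sum_g p g ^+ 2 = #|row_group|%:R ^+ 2 * young_scalar.
  have sE (f : {perm X} -> F) : \sum_h young_coef h * f h =
      \sum_(s in row_group) \sum_(t in col_group) (-1) ^+ odd_perm t * f (s * t)%g.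
    exact: (esym (@young_coefE F idfun f)).
  have -> : young_scalar =
     \sum_(s in row_group) \sum_(t in col_group) (-1) ^+ odd_perm t * young_coef (t * s)%g.
    rewrite /young_scalar sE (reindex_inj invg_inj) /=.
    apply: eq_big => s; first by rewrite groupV.
    move=> _; rewrite (reindex_inj invg_inj) /=.
    apply: eq_big => t; first by rewrite groupV.
    by move=> _; rewrite odd_permV invMg !invgK.
  have -> : \sum_g p g ^+ 2 = #|row_group|%:R * \sum_g young_coef g * p g.
    transitivity (\sum_g \sum_(s in row_group) young_coef g * p g).
      rewrite exchange_big /=.
      under eq_bigr => g _ do rewrite expr2 {1}/p mulr_suml.
      rewrite exchange_big /=; apply: eq_bigr => s sR.
      rewrite [RHS](reindex_inj (mulIg s)) /=; apply: eq_bigr => g _.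
      congr (_ * _); rewrite /p [in LHS](reindex_inj (mulgI s)) /=.
      by apply: eq_big => t; rewrite ?groupMl // mulgA.
    by rewrite mulr_sumr; apply: eq_bigr => g _; rewrite sumr_const mulr_natl.
  rewrite expr2 -!mulrA; congr (_ * _); rewrite sE.
  rewrite [RHS]mulr_natl -sumr_const; apply: eq_bigr => s sR.
  rewrite exchange_big /=; apply: eq_bigr => t tC.
  by rewrite /p mulr_sumr; apply: eq_bigr => u _; rewrite -mulgA er.
have : 0 < \sum_g p g ^+ 2.
  have p0 g : 0 <= p g ^+ 2.
    rewrite real_exprn_even_ge0 // /p rpred_sum // => s _.
    exact: young_coef_real.
  rewrite (bigD1 1%g) //= ltr_wpDr ?sumr_ge0 //.
  have -> : p 1%g = #|row_group|%:R.
    rewrite /p -sumr_const; apply: eq_bigr => s sR.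
    by rewrite mul1g -[s]mulg1 er // young_coef1.
  by rewrite exprn_gt0 // ltr0n cardG_gt0.
by rewrite pE; apply: contraTneq => ->; rewrite mulr0 ltxx.
Qed.

End Functions.
End YoungSymmetrizer.

(** * Young symmetrizers of subsets, as operators *)

Section YoungProduct.

Variables (K : comPzRingType) (X : finType) (I : eqType).
Variables (comp : X -> I) (row col : X -> nat).
Variable act : {perm X} -> {rmorphism K -> K}.
Hypothesis actM : forall (s t : {perm X}) u, act (s * t)%g u = act t (act s u).

Local Notation row_perms B := (stab (fun k => (comp k, row k)) B).
Local Notation col_perms B := (stab (fun k => (comp k, col k)) B).

Definition young_on (B : {set X}) (u : K) : K :=
  \sum_(s in row_perms B) \sum_(t in col_perms B)
    (-1) ^+ odd_perm t * act t (act s u).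

Lemma young_onD B u v : young_on B (u + v) = young_on B u + young_on B v.
Proof.
rewrite /young_on -big_split; apply: eq_bigr => s _; rewrite -big_split.
by apply: eq_bigr => t _; rewrite !rmorphD mulrDr.
Qed.

Lemma young_onZ B c u : (forall s, act s c = c) ->
  young_on B (c * u) = c * young_on B u.
Proof.
move=> act_c; rewrite /young_on mulr_sumr; apply: eq_bigr => s _.
rewrite mulr_sumr; apply: eq_bigr => t _.
by rewrite rmorphM act_c rmorphM act_c mulrCA.
Qed.

Lemma young_on0 u : act 1%g u = u -> young_on set0 u = u.
Proof.
move=> act1; have stab0 (Y : eqType) (q : X -> Y) : stab q set0 = [set 1%g].
  apply/setP => s; rewrite in_set1; apply/stabP/eqP => [[s0 _]|->].
    by apply/permP => k; rewrite perm1 (out_perm s0) ?inE.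
  by split=> [|k]; [apply: perm_on1 | rewrite perm1].
by rewrite /young_on !stab0 !big_set1 odd_perm1 expr0 mul1r !act1.
Qed.

(** The operators for disjoint sets commute, so that the row sums can be moved
    before the signed column sums. *)
Lemma young_onU (A B : {set X}) u : [disjoint A & B] ->
    (forall k l, comp k = comp l -> k \in A -> l \in A) ->
  young_on A (young_on B u) = young_on (A :|: B) u.
Proof.
move=> dAB cA; rewrite /young_on [RHS]sum_stabU //; last first.
  by move=> k l [/cA h _]; apply: h.
apply: eq_bigr => s1 /stabP[s1A _].
transitivity (\sum_(t1 in col_perms A) \sum_(s2 in row_perms B)
    \sum_(t2 in col_perms B) (-1) ^+ odd_perm t1 * (-1) ^+ odd_perm t2 *
      act (s2 * t2 * s1 * t1)%g u).
  apply: eq_bigr => t1 _; rewrite !rmorph_sum mulr_sumr; apply: eq_bigr => s2 _.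
  rewrite !rmorph_sum mulr_sumr; apply: eq_bigr => t2 _.
  by rewrite !rmorphM !rmorph_sign !actM mulrA.
rewrite exchange_big /=; apply: eq_bigr => s2 /stabP[s2B _].
rewrite [RHS]sum_stabU //; last by move=> k l [/cA h _]; apply: h.
apply: eq_bigr => t1 /stabP[t1A _]; apply: eq_bigr => t2 /stabP[t2B _].
have comm v w : perm_on A v -> perm_on B w -> (w * v = v * w)%g.
  by move=> vA wB; apply/esym/(perm_onC vA wB); rewrite -setI_eq0 in dAB *;
    rewrite ?(eqP dAB).
rewrite odd_permM signr_addb -!actM; congr (_ * act _ u).
rewrite -(mulgA s2) (comm _ _ s1A t2B) mulgA (comm _ _ s1A s2B) -!mulgA.
by rewrite (comm _ _ t1A t2B).
Qed.

Lemma foldr_young_on (f : I -> K -> K) (c : I -> K) (s : seq I) u :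
    (forall u, act 1%g u = u) -> (forall g i, act g (c i) = c i) ->
    (forall i u, f i u = c i * young_on [set k | comp k == i] u) -> uniq s ->
  foldr f u s = (\prod_(i <- s) c i) * young_on [set k | comp k \in s] u.
Proof.
move=> act1 act_c fE; elim: s => [_|i s IH /= /andP[i_s us]] /=.
  rewrite big_nil mul1r (_ : [set k | _] = set0); first by rewrite young_on0.
  by apply/setP => k; rewrite !inE.
have -> : [set k | comp k \in i :: s] =
    [set k | comp k == i] :|: [set k | comp k \in s].
  by apply/setP => k; rewrite !inE.
rewrite -young_onU.
- rewrite IH // fE young_onZ ?big_cons ?mulrA // => g.
  by rewrite rmorph_prod; apply: eq_bigr.
- rewrite disjoint_subset; apply/subsetP => k; rewrite !inE => /eqP->.
  exact: i_s.
- by move=> k l kl; rewrite !inE kl.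
Qed.

End YoungProduct.

(** * Operators on a Galois cover *)

Section Operators.

(* K is the function field of the cover, OU its ring of regular functions, k the
   embedding of the constants, DV the algebra of differential operators of the
   base and dy j its derivations. *)
Variables (F : numFieldType) (K : fieldType) (k : {rmorphism F -> K}).
Variables (OU : K -> Prop) (DV : (K -> K) -> Prop).
Variables (J : finType) (dy : J -> K -> K).

Hypothesis OU_k : forall c, OU (k c).
Hypothesis OUD : forall u v, OU u -> OU v -> OU (u + v).
Hypothesis OUM : forall u v, OU u -> OU v -> OU (u * v).

Hypothesis DV_OU : forall P u, DV P -> OU u -> OU (P u).
Hypothesis DVD : forall P u v, DV P -> OU u -> OU v -> P (u + v) = P u + P v.
Hypothesis DV_comp : forall P Q, DV P -> DV Q -> DV (fun u => P (Q u)).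
Hypothesis DV_add : forall P Q, DV P -> DV Q -> DV (fun u => P u + Q u).
Hypothesis DV_dy : forall j, DV (dy j).
Hypothesis dyM : forall j u v, OU u -> OU v ->
  dy j (u * v) = dy j u * v + u * dy j v.
Hypothesis dy_k : forall j c, dy j (k c) = 0.

(** The differential operators of the cover. Building them by multiplication on
    the left only is enough, see [DU_comp], and makes the normal form below
    immediate. *)
Inductive DU : (K -> K) -> Prop :=
| DU_id : DU (fun u => u)
| DU_mul b T : OU b -> DU T -> DU (fun u => b * T u)
| DU_dy j T : DU T -> DU (fun u => dy j (T u))
| DU_add S T : DU S -> DU T -> DU (fun u => S u + T u).

Lemma DU_comp S T : DU S -> DU T -> DU (fun u => S (T u)).
Proof.
move=> hS hT; elim: hS => [|b S' hb _ IH|j S' _ IH|S1 S2 _ IH1 _ IH2] //.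
- exact: DU_mul hb IH.
- exact: DU_dy IH.
- exact: DU_add IH1 IH2.
Qed.

Lemma DU_OU T u : DU T -> OU u -> OU (T u).
Proof.
move=> hT hu; elim: hT => [|b S hb _ IH|j S _ IH|S1 S2 _ IH1 _ IH2] //.
- exact: OUM.
- exact: DV_OU.
- exact: OUD.
Qed.

Lemma DUD T u v : DU T -> OU u -> OU v -> T (u + v) = T u + T v.
Proof.
move=> hT hu hv; elim: hT => [|b S _ _ ->|j S hS ->|S1 S2 _ -> _ ->] //.
- by rewrite mulrDr.
- by rewrite (DVD (DV_dy j)) //; apply: DU_OU.
- by rewrite addrACA.
Qed.

Lemma OU_0 : OU 0. Proof. by rewrite -(rmorph0 k). Qed.

Lemma OU_sum (A : Type) (s : seq A) (P : pred A) (f : A -> K) :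
  (forall x, P x -> OU (f x)) -> OU (\sum_(x <- s | P x) f x).
Proof. by move=> h; apply: big_ind => //; apply: OU_0. Qed.

Lemma DU_zero T : DU T -> T 0 = 0.
Proof.
by move=> hT; apply: (addrI (T 0)); rewrite -DUD // ?addr0 //; apply: OU_0.
Qed.

Lemma DUk T c u : DU T -> OU u -> T (k c * u) = k c * T u.
Proof.
move=> hT hu; elim: hT => [|b S _ _ ->|j S hS ->|S1 S2 _ -> _ ->] //.
- by rewrite mulrCA.
- by rewrite dyM // ?dy_k ?mul0r ?add0r //; apply: DU_OU.
- by rewrite mulrDr.
Qed.

Lemma DU_sum T (A : Type) (s : seq A) (P : pred A) (f : A -> K) : DU T ->
  (forall x, P x -> OU (f x)) ->
  T (\sum_(x <- s | P x) f x) = \sum_(x <- s | P x) T (f x).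
Proof.
move=> hT hf; elim: s => [|x s IH]; first by rewrite !big_nil DU_zero.
rewrite !big_cons; case: ifP => // Px; rewrite DUD ?IH //; first exact: hf.
exact: OU_sum.
Qed.

Hypothesis dy_const : forall u, OU u -> (forall j, dy j u = 0) ->
  exists c, u = k c.
Hypothesis DU_unit : forall u, OU u -> u != 0 -> exists2 T, DU T & T u = 1.

(** A form of the density theorem, by induction on the list. If T is as wanted
    for us but T u is not constant, some derivative of T u is nonzero and can be
    brought to 1 by an operator; the resulting operator R kills v and us, whose
    images under T are constant, while R u = 1. Then T - (T u) R works for
    u :: us. *)
Lemma DU_density v (us : seq K) : OU v -> v != 0 ->
    (forall u, u \in us -> OU u) ->
  exists T, [/\ DU T, T v = 1 & forall u, u \in us -> exists c, T u = k c].
Proof.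
move=> hv v0; elim: us => [|u us IH] hus.
  by have [T hT Tv] := DU_unit hv v0; exists T.
have [|T [hT Tv Tus]] := IH; first by move=> w w_us; apply: hus; rewrite inE w_us orbT.
have hu : OU u by apply: hus; rewrite inE eqxx.
have hTu := DU_OU hT hu.
have [/forallP h0|/forallPn [j hj]] := boolP [forall j, dy j (T u) == 0].
  exists T; split=> // w; rewrite inE => /orP[/eqP ->|/Tus //].
  by apply: dy_const => // j; apply/eqP.
have [S hS Su] := DU_unit (DV_OU (DV_dy j) hTu) hj.
have hR : DU (fun w => S (dy j (T w))) by apply: DU_comp hS _; apply: DU_dy.
have Rk c w : T w = k c -> S (dy j (T w)) = 0 by move=> ->; rewrite dy_k DU_zero.
exists (fun w => T w + - T u * S (dy j (T w))); split.
- apply: (DU_add hT); apply: DU_mul hR.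
  by rewrite -mulN1r -(rmorphN1 k); apply: OUM.
- by rewrite (Rk 1) ?Tv ?rmorph1 // mulr0 addr0.
move=> w; rewrite inE => /orP[/eqP ->|/Tus [c Tw]].
  by exists 0; rewrite Su mulr1 subrr rmorph0.
by exists c; rewrite (Rk c) // mulr0 addr0.
Qed.

(** Sums of operators a P with a in O_U and P in D_V, which can be averaged: the
    sum of the conjugates of a P is P followed by the sum of the conjugates of
    a. *)
Inductive normal_form : (K -> K) -> Prop :=
| normal_mul a P : OU a -> DV P -> normal_form (fun u => a * P u)
| normal_add S T : normal_form S -> normal_form T ->
    normal_form (fun u => S u + T u).

Hypothesis DV_one : exists2 P, DV P & forall u, OU u -> P u = u.

Lemma normal_OU T u : normal_form T -> OU u -> OU (T u).
Proof.
move=> hT hu; elim: hT => [a P ha hP|S1 S2 _ h1 _ h2].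
  by apply: OUM => //; apply: DV_OU.
exact: OUD.
Qed.

Lemma DU_normal_form T : DU T ->
  exists2 S, normal_form S & forall u, OU u -> T u = S u.
Proof.
have mul b S : OU b -> normal_form S ->
    exists2 S', normal_form S' & forall u, OU u -> S' u = b * S u.
  move=> hb; elim=> [a P ha hP|S1 S2 _ [S1' h1 e1] _ [S2' h2 e2]].
    exists (fun u => (b * a) * P u); last by move=> u; rewrite mulrA.
    by apply: normal_mul => //; apply: OUM.
  exists (fun u => S1' u + S2' u); first exact: normal_add.
  by move=> u hu; rewrite e1 // e2 // mulrDr.
have der j S : normal_form S ->
    exists2 S', normal_form S' & forall u, OU u -> S' u = dy j (S u).
  elim=> [a P ha hP|S1 S2 n1 [S1' h1 e1] n2 [S2' h2 e2]].
    exists (fun u => dy j a * P u + a * dy j (P u)).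
      apply: normal_add; first by apply: normal_mul => //; apply: DV_OU.
      by apply: normal_mul => //; apply: DV_comp.
    by move=> u hu; rewrite dyM //; apply: DV_OU.
  exists (fun u => S1' u + S2' u); first exact: normal_add.
  by move=> u hu; rewrite e1 // e2 // (DVD (DV_dy j)) //; apply: normal_OU.
elim=> [|b S hb _ [S' h e]|j S _ [S' h e]|S1 S2 _ [S1' h1 e1] _ [S2' h2 e2]].
- have [P hP eP] := DV_one; exists (fun u => k 1 * P u); first exact: normal_mul.
  by move=> u hu; rewrite rmorph1 mul1r eP.
- by have [S'' h' e'] := mul b S' hb h; exists S'' => // u hu; rewrite e // e'.
- by have [S'' h' e'] := der j S' h; exists S'' => // u hu; rewrite e // e'.
- exists (fun u => S1' u + S2' u); first exact: normal_add.
  by move=> u hu; rewrite e1 // e2.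
Qed.

Variables (X : finType) (I : eqType) (comp : X -> I) (row col : X -> nat).
Hypothesis box_inj : forall k l,
  comp k = comp l -> row k = row l -> col k = col l -> k = l.
Hypothesis box_closed : forall k i, (i <= row k)%N ->
  exists l, [/\ comp l = comp k, row l = i & col l = col k].

Local Notation row_group := (stab (fun k => (comp k, row k)) [set: X]).
Local Notation col_group := (stab (fun k => (comp k, col k)) [set: X]).
Local Notation G := (stab comp [set: X]).
Local Notation coef := (young_coef comp row col F).

Variable act : {perm X} -> {rmorphism K -> K}.
Local Notation young_op := (young_on comp row col act [set: X]).
Hypothesis actM : forall (s t : {perm X}) u, act (s * t)%g u = act t (act s u).
Hypothesis act1 : forall u, act 1%g u = u.
Hypothesis act_k : forall s c, act s (k c) = k c.
Hypothesis OU_act : forall s u, s \in G -> OU u -> OU (act s u).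
Hypothesis DV_act : forall P s u, DV P -> s \in G -> OU u ->
  P (act s u) = act s (P u).
Hypothesis DV_invariant : forall a, OU a -> (forall s, s \in G -> act s a = a) ->
  exists2 P, DV P & forall u, OU u -> P u = a * u.

(** P commutes with the group, so that the conjugates of a P only differ by the
    conjugates of a, whose sum is invariant. *)
Lemma average_DV T : DU T ->
  exists2 P, DV P &
    forall u, OU u -> P u = \sum_(g in G) act g (T (act g^-1%g u)).
Proof.
move=> /DU_normal_form [S hS eS].
suff [P hP eP] : exists2 P, DV P &
    forall u, OU u -> P u = \sum_(g in G) act g (S (act g^-1%g u)).
  exists P => // u hu; rewrite eP //; apply: eq_bigr => g gG.
  by rewrite eS //; apply: OU_act; rewrite ?groupV.
elim: hS => [a P ha hP|S1 S2 _ [P1 h1 e1] _ [P2 h2 e2]]; last first.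
  exists (fun u => P1 u + P2 u); first exact: DV_add.
  by move=> u hu; rewrite e1 // e2 // -big_split; apply: eq_bigr => g _; rewrite rmorphD.
have [|s sG|Q hQ eQ] := DV_invariant (a := \sum_(g in G) act g a).
- by apply: OU_sum => g gG; apply: OU_act.
- rewrite rmorph_sum [RHS](reindex_inj (mulIg s)) /=.
  by apply: eq_big => g; rewrite ?groupMr // actM.
exists (fun u => Q (P u)); first exact: DV_comp.
move=> u hu; rewrite eQ; last exact: DV_OU.
rewrite mulr_suml; apply: eq_bigr => g gG; rewrite rmorphM; congr (_ * _).
by rewrite -(DV_act hP gG (OU_act (groupVr gG) hu)) -actM mulVg act1.
Qed.

Definition symmetrize (u : K) : K := \sum_(s in row_group) act s u.

Lemma young_opE u : young_op u = \sum_g k (coef g) * act g u.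
Proof.
rewrite -young_coefE; apply: eq_bigr => s _; apply: eq_bigr => t _.
by rewrite actM.
Qed.

Lemma young_op_symmetrize u : young_op u =
  \sum_(t in col_group) (-1) ^+ odd_perm t * act t (symmetrize u).
Proof.
rewrite /young_on exchange_big; apply: eq_bigr => t _.
by rewrite /symmetrize rmorph_sum mulr_sumr.
Qed.

Lemma OU_sign (b : bool) : OU ((-1) ^+ b).
Proof. by rewrite -(rmorph_sign k). Qed.

Lemma symmetrize_OU u : OU u -> OU (symmetrize u).
Proof.
by move=> hu; apply: OU_sum => s /row_sub_block sG; apply: OU_act.
Qed.

Lemma young_op_OU u : OU u -> OU (young_op u).
Proof.
move=> hu; rewrite young_op_symmetrize; apply: OU_sum => t /col_sub_block tG.
by apply: OUM; [apply: OU_sign | apply: OU_act => //; apply: symmetrize_OU].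
Qed.

Lemma DV_young_op P u : DV P -> OU u -> P (young_op u) = young_op (P u).
Proof.
move=> hP hu; have P0 : P 0 = 0.
  by apply: (addrI (P 0)); rewrite -DVD // ?addr0 //; apply: OU_0.
have Psum (A : Type) (s : seq A) (B : pred A) f : (forall x, B x -> OU (f x)) ->
    P (\sum_(x <- s | B x) f x) = \sum_(x <- s | B x) P (f x).
  move=> hf; elim: s => [|x s IH]; first by rewrite !big_nil P0.
  rewrite !big_cons; case: ifP => // Bx; rewrite DVD ?IH //; first exact: hf.
  exact: OU_sum.
have Psign (b : bool) w : OU w -> P ((-1) ^+ b * w) = (-1) ^+ b * P w.
  move=> hw; case: b; rewrite ?expr0 ?mul1r // expr1 !mulN1r.
  apply: (addrI (P w)); rewrite subrr -DVD ?subrr //.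
  by rewrite -mulN1r -(rmorphN1 k); apply: OUM.
have hts s t : s \in row_group -> t \in col_group -> OU (act t (act s u)).
  by move=> /row_sub_block sG /col_sub_block tG; do 2![apply: OU_act => //].
rewrite /young_on Psum => [|s sR]; last first.
  by apply: OU_sum => t tC; apply: OUM; [apply: OU_sign | apply: hts].
apply: eq_bigr => s sR; rewrite Psum => [|t tC]; last first.
  by apply: OUM; [apply: OU_sign | apply: hts].
apply: eq_bigr => t tC; have := hts s t sR tC => hst; rewrite Psign //.
have sG := row_sub_block sR; have tG := col_sub_block tC.
by rewrite (DV_act hP tG (OU_act sG hu)) (DV_act hP sG hu).
Qed.

Lemma young_op_sqr u :
  young_op (young_op u) = k (young_scalar comp row col F) * young_op u.
Proof.
rewrite [LHS]young_opE.
transitivity (\sum_h \sum_g k (coef h * coef (h^-1 * g)%g) * act g u).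
  under eq_bigr => h _ do rewrite young_opE (rmorph_sum (act h)) mulr_sumr.
  rewrite exchange_big /=; apply: eq_bigr => h _.
  rewrite [RHS](reindex_inj (mulgI h)) /=; apply: eq_bigr => g _.
  by rewrite mulKg rmorphM act_k actM rmorphM mulrA [k _ * k _]mulrC.
rewrite exchange_big young_opE mulr_sumr; apply: eq_bigr => g _.
rewrite -mulr_suml mulrA -rmorphM -rmorph_sum.
by rewrite (young_coef_sqr box_inj box_closed).
Qed.

Lemma act_young_op t u : t \in col_group ->
  act t (young_op u) = (-1) ^+ odd_perm t * young_op u.
Proof.
move=> tC; rewrite !young_op_symmetrize rmorph_sum mulr_sumr.
rewrite [RHS](reindex_inj (mulIg t)) /=; apply: eq_big => s; first by rewrite groupMr.
move=> _; rewrite rmorphM rmorph_sign actM odd_permM signr_addb mulrA; congr (_ * _).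
by rewrite mulrCA -signr_addb addbb expr0 mulr1.
Qed.

Definition young_image (v : K) : Prop := exists2 u, OU u & v = young_op u.

(** The operator P below is the average of u |-> a w * T u. Its value at v is the
    combination of the translates of w with coefficients x, a biequivariant
    function because the row symmetrizer of w absorbs the row group and v is
    antisymmetric under the column group. *)
Theorem young_image_simple (N : K -> Prop) :
    (forall P u, DV P -> N u -> N (P u)) -> (forall u, N u -> young_image u) ->
    (exists2 v, N v & v != 0) ->
  forall u, young_image u -> N u.
Proof.
move=> N_DV N_sub [v Nv v0] _ [w hw ->].
have [v' hv' vE] := N_sub v Nv; have hv : OU v by rewrite vE; apply: young_op_OU.
(* The column antisymmetrizer maps symmetrize v to a nonzero multiple of v. *)
have av0 : symmetrize v != 0.
  apply: contraNneq v0 => av0; have : young_op v = 0.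
    by rewrite young_op_symmetrize av0 big1 // => t _; rewrite rmorph0 mulr0.
  rewrite vE young_op_sqr => /eqP; rewrite mulf_eq0 fmorph_eq0.
  by rewrite (negPf (young_scalar_neq0 box_inj F)).
have [u|T [hT Tav Tg]] :=
    DU_density (us := [seq act g v | g in G]) (symmetrize_OU hv) av0.
  by case/mapP => g; rewrite mem_enum => gG ->; apply: OU_act.
have [l lE] : exists l : {perm X} -> F, forall g, g \in G -> T (act g v) = k (l g).
  apply: (@fin_all_exists {perm X} (fun=> F)
     (fun g c => g \in G -> T (act g v) = k c)) => g.
  have [gG|_] := boolP (g \in G); last by exists 0.
  by have [|c ->] := Tg (act g v); [apply: image_f | exists c].
(* Only the block group is averaged over, hence the value 0 outside of it. *)
pose l' g := if g \in G then l g^-1%g else 0.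
have hS : DU (fun u => symmetrize w * T u) by apply: DU_mul (symmetrize_OU hw) hT.
have [P hP PE] := average_DV hS.
pose x t := \sum_(s in row_group) l' (s^-1 * t)%g.
have Pv : P v = \sum_t k (x t) * act t w.
  rewrite PE //; transitivity (\sum_g k (l' g) * act g (symmetrize w)).
    rewrite big_mkcond; apply: eq_bigr => g _; rewrite /l'.
    case: ifP => gG; last by rewrite rmorph0 mul0r.
    by rewrite lE ?groupV // rmorphM act_k mulrC.
  under [RHS]eq_bigr => t _ do rewrite rmorph_sum mulr_suml.
  rewrite [RHS]exchange_big /=.
  under eq_bigr => g _ do rewrite rmorph_sum mulr_sumr.
  rewrite exchange_big; apply: eq_bigr => s _ /=.
  rewrite [RHS](reindex_inj (mulgI s)) /=; apply: eq_bigr => g _.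
  by rewrite mulKg actM.
have l'C g t : t \in col_group -> l' (g * t)%g = (-1) ^+ odd_perm t * l' g.
  move=> tC; have tG := col_sub_block tC; rewrite /l' groupMr //.
  case: ifP => gG; last by rewrite mulr0.
  apply: (fmorph_inj k); rewrite rmorphM rmorph_sign -!lE ?groupV ?groupM //.
  rewrite invMg actM {1}vE act_young_op ?groupV // odd_permV -vE rmorphM.
  rewrite -(rmorph_sign k) act_k DUk //; apply: OU_act => //.
  by rewrite groupV.
have xE g : x g = coef g.
  rewrite (biequivariant_young_coef box_inj box_closed (x := x)).
  - suff -> : x 1%g = 1 by rewrite mul1r.
    apply: (fmorph_inj k); rewrite rmorph1 -Tav rmorph_sum DU_sum //; last first.
      by move=> s /row_sub_block sG; apply: OU_act.
    apply: eq_bigr => s /row_sub_block sG.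
    by rewrite mulg1 /l' groupV sG invgK lE.
  - split=> [s h sR|h t tC].
      rewrite /x (reindex_inj (mulgI s)) /=; apply: eq_big => t.
        by rewrite groupMl.
      by rewrite invMg -mulgA mulKg.
    by rewrite /x mulr_sumr; apply: eq_bigr => s _; rewrite mulgA l'C.
  - move=> h hG; apply: big1 => s /row_sub_block sG.
    by rewrite /l' groupMl ?groupV // (negPf hG).
have -> : young_op w = P v.
  by rewrite Pv young_opE; apply: eq_bigr => g _; rewrite xE.
exact: N_DV.
Qed.

End Operators.

(** * Polynomials and their block symmetric generators *)

Lemma msymXU (A : nzRingType) n (s : 'S_n) k :
  msym s ('X_k : {mpoly A[n]}) = 'X_(s k).
Proof.
rewrite msymX; congr 'X_[_]; apply/mnmP => j; rewrite mnmE !mnm1E.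
by rewrite -(inj_eq (@perm_inj _ s)) permKV.
Qed.

Section Coordinates.

Variables (F : numFieldType) (n r : nat) (blk : 'I_n -> 'I_r).

Local Notation OX := {mpoly F[n]}.
Local Notation G := (stab blk [set: 'I_n]).
Local Notation block i := [set k | blk k == i].

Lemma mpoly_alg_ind (P : OX -> Prop) :
    (forall c, P c%:MP) -> (forall k, P 'X_k) ->
    (forall p q, P p -> P q -> P (p + q)) ->
    (forall p q, P p -> P q -> P (p * q)) ->
  forall p, P p.
Proof.
move=> PC PX PD PM p; rewrite [p]mpolyE; apply: big_ind => //.
  by rewrite -(mpolyC0 n F).
move=> m _; rewrite -mul_mpolyC; apply: (PM) => //; rewrite mpolyXE_id.
apply: big_ind => // [|k _]; first by rewrite -(mpolyC1 n F).
by elim: (m k) => [|l IH]; rewrite ?expr0 ?exprS -?(mpolyC1 n F); [|apply: PM].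
Qed.

Definition supported (B : {set 'I_n}) (p : OX) : Prop :=
  forall m, m \in msupp p -> forall k, k \notin B -> m k = 0%N.

Lemma supportedD (B : {set 'I_n}) (p q : OX) :
  supported B p -> supported B q -> supported B (p + q).
Proof.
by move=> hp hq m /msuppD_le; rewrite mem_cat => /orP[/hp|/hq].
Qed.

Lemma supportedM (B : {set 'I_n}) (p q : OX) :
  supported B p -> supported B q -> supported B (p * q).
Proof.
move=> hp hq m /msuppM_le /allpairsP[[m1 m2] /= [/hp h1 /hq h2 ->]] k kB.
by rewrite mnmDE h1 // h2.
Qed.

Lemma supportedC (B : {set 'I_n}) c : supported B (c%:MP : OX).
Proof.
move=> m; rewrite mcoeff_msupp mcoeffC => /eqP; case: eqP => [-> _|_].
  by move=> k _; rewrite mnm0E.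
by rewrite mulr0.
Qed.

Lemma supportedX (B : {set 'I_n}) (m : 'X_{1..n}) :
  (forall k, k \notin B -> m k = 0%N) -> supported B ('X_[m] : OX).
Proof. by move=> h m'; rewrite msuppX inE => /eqP->. Qed.

Lemma msym_monomial (s : 'S_n) (m : 'X_{1..n}) :
  msym s 'X_[m] = \prod_k 'X_(s k) ^+ m k :> OX.
Proof.
rewrite msymX (mpolyXE _ s); apply: eq_bigr => k _.
by rewrite mnmE permK.
Qed.

Lemma msym_supported (B : {set 'I_n}) (s t : 'S_n) (p : OX) :
  {in B, s =1 t} -> supported B p -> msym s p = msym t p.
Proof.
move=> st hp; rewrite [p]mpolyE !raddf_sum; apply: eq_big_seq => m mp /=.
rewrite !msymZ; apply: (congr1 ( *:%R p@_m)); rewrite !msym_monomial.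
apply: eq_bigr => k _.
by case: (boolP (k \in B)) => kB; [rewrite st | rewrite (hp m) // !expr0].
Qed.

Lemma msym_supportedE (B : {set 'I_n}) (s : 'S_n) (p : OX) :
  perm_on B s -> supported B p -> supported B (msym s p).
Proof.
move=> sB hp m; rewrite mcoeff_msupp mcoeff_sym -mcoeff_msupp => /hp h k kB.
by have := h k kB; rewrite mnmE (out_perm sB).
Qed.

Definition block_symmetric i (p : OX) : Prop :=
  supported (block i) p /\
  forall s : 'S_n, perm_on (block i) s -> msym s p = p.

Lemma perm_on_block i (s : 'S_n) : perm_on (block i) s -> s \in G.
Proof.
move=> sB; apply/stabP; split=> [|k]; first by apply/subsetP => k; rewrite inE.
have [kB|kB] := boolP (k \in block i); last by rewrite (out_perm sB).
have := kB; rewrite -(perm_closed k sB) inE => /eqP->.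
by move: kB; rewrite inE => /eqP->.
Qed.

Lemma block_symmetricG i (p : OX) s : block_symmetric i p -> s \in G ->
  msym s p = p.
Proof.
move=> [hp pinv] sG; rewrite -[RHS](pinv _ (restr_perm_on (block i) s)).
apply: msym_supported hp => k kB; rewrite restr_permE //.
by apply/astabsP => l; rewrite /= /aperm !inE; case/stabP: sG => _ ->.
Qed.

Variable y : 'I_n -> OX.
Hypothesis y_sym : forall j, block_symmetric (blk j) (y j).
Hypothesis y_gen : forall i p, block_symmetric i p ->
  exists q, p = q \mPo [tuple y j | j < n].

Definition sy (p : OX) : OX := p \mPo [tuple y j | j < n].

Lemma sy_C c : sy c%:MP = c%:MP.
Proof. exact: comp_mpolyC. Qed.

Lemma sy_0 : sy 0 = 0. Proof. exact: comp_mpoly0. Qed.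
Lemma sy_1 : sy 1 = 1. Proof. exact: comp_mpoly1. Qed.
Lemma sy_Z c p : sy (c *: p) = c *: sy p. Proof. exact: comp_mpolyZ. Qed.

Lemma sy_D p q : sy (p + q) = sy p + sy q.
Proof. exact: comp_mpolyD. Qed.

Lemma sy_M p q : sy (p * q) = sy p * sy q.
Proof. exact: (rmorphM (comp_mpoly [tuple y j | j < n])). Qed.

Lemma sy_X j : sy 'X_j = y j.
Proof. by rewrite /sy comp_mpolyXU -tnth_nth tnth_mktuple. Qed.

Lemma sy_invariant q s : s \in G -> msym s (sy q) = sy q.
Proof.
move=> sG; elim/mpoly_alg_ind: q => [c|j|p q hp hq|p q hp hq].
- by rewrite sy_C -[c%:MP]mulr1 mul_mpolyC msymZ msym1.
- by rewrite sy_X (block_symmetricG (y_sym j)).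
- by rewrite sy_D msymD hp hq.
- by rewrite sy_M msymM hp hq.
Qed.

Definition block_sum i (p : OX) : OX := \sum_(s in Sym (block i)) msym s p.

Lemma block_sum_invariant i p : supported (block i) p ->
  block_symmetric i (block_sum i p).
Proof.
move=> hp; split=> [|s sB].
  apply: big_ind => [||s]; first by rewrite -(mpolyC0 n F); apply: supportedC.
    exact: supportedD.
  by rewrite inE => sB; apply: msym_supportedE.
rewrite /block_sum raddf_sum [RHS](reindex_inj (mulIg s)) /=.
apply: eq_big => t; last by rewrite msymMm.
by rewrite groupMr // inE.
Qed.

Lemma block_sumM i f g q : supported (block i) f ->
    supported (~: block i) g ->
  block_sum i (sy q * (f * g)) = sy q * (block_sum i f * g).
Proof.
move=> hf hg; rewrite /block_sum [X in _ = _ * X]mulr_suml [RHS]mulr_sumr; apply: eq_bigr => s.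
rewrite inE => sB; rewrite !msymM sy_invariant.
  rewrite (@msym_supported (~: block i) s 1%g g) ?msym1m // => k.
  by rewrite inE perm1 => /(out_perm sB).
exact: perm_on_block sB.
Qed.

Lemma block_sums_monomial (s : seq 'I_r) (f : 'I_r -> OX) q : uniq s ->
    (forall i, supported (block i) (f i)) ->
  exists q', foldl (fun p i => block_sum i p) (sy q * \prod_(i <- s) f i) s
             = sy q'.
Proof.
move=> + hf; elim: s q => /= [|i s IH] q; first by rewrite big_nil mulr1; exists q.
case/andP => i_s us; rewrite big_cons block_sumM //; last first.
  rewrite big_seq; apply: big_ind => [||j js].
  - by rewrite -(mpolyC1 n F); apply: supportedC.
  - exact: supportedM.
  move=> m /hf h k; rewrite inE negbK => kB; apply: h.
  move: kB; rewrite !inE => /eqP->; apply: contraNneq i_s => ->; exact: js.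
have [q1 ->] := y_gen (block_sum_invariant (hf i)); rewrite -/(sy q1).
by rewrite mulrA -sy_M; apply: IH.
Qed.

(** Summing over the symmetric groups of the blocks one after the other turns a
    monomial into a product of block invariants, and multiplies an invariant by
    a nonzero constant. *)
Lemma invariant_sy (p : OX) : (forall s, s \in G -> msym s p = p) ->
  exists q, p = sy q.
Proof.
move=> pG; pose A := foldl (fun p i => block_sum i p).
have AD s p1 p2 : A (p1 + p2) s = A p1 s + A p2 s.
  elim: s p1 p2 => //= i s IH p1 p2; rewrite -IH; congr (A _ _).
  by rewrite /block_sum -big_split; apply: eq_bigr => t _; rewrite msymD.
have AZ s c p1 : A (c *: p1) s = c *: A p1 s.
  elim: s p1 => //= i s IH p1; rewrite -IH; congr (A _ _).
  by rewrite /block_sum scaler_sumr; apply: eq_bigr => t _; rewrite msymZ.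
have Ap s : exists2 c : F, c != 0 & A p s = c *: p.
  elim: s => [|i s [c c0 IH]]; first by exists 1; rewrite ?oner_neq0 ?scale1r.
  exists (#|Sym (block i)|%:R * c).
    by rewrite mulf_neq0 // pnatr_eq0 -lt0n cardG_gt0.
  rewrite -scalerA -IH -AZ /=; congr (A _ _); rewrite scaler_nat -sumr_const.
  by apply: eq_bigr => t; rewrite inE => /perm_on_block; apply: pG.
have AX m : exists q, A 'X_[m] (enum 'I_r) = sy q.
  pose f i : OX := 'X_[ [multinom if k \in block i then m k else 0%N | k < n] ].
  have -> : 'X_[m] = sy 1 * \prod_(i <- enum 'I_r) f i.
    rewrite sy_1 mul1r big_enum /= /f -(big_morph _ (@mpolyXD _ _) (mpolyX0 _ _)).
    congr 'X_[_]; apply/mnmP => k; rewrite mnm_sumE (bigD1 (blk k)) //=.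
    rewrite mnmE inE eqxx big1 ?addn0 // => i; rewrite mnmE inE eq_sym.
    by move/negPf->.
  apply: block_sums_monomial => [|i]; first exact: enum_uniq.
  by apply: supportedX => k kB; rewrite mnmE (negPf kB).
have Aq (p1 : OX) : exists q, A p1 (enum 'I_r) = sy q.
  rewrite [p1]mpolyE; elim: (msupp p1) => [|m ms [q IH]].
    exists 0; rewrite big_nil sy_0.
    by apply: (addrI (A 0 (enum 'I_r))); rewrite -AD !addr0.
  have [q' hq'] := AX m; exists (p1@_m *: q' + q).
  by rewrite big_cons AD AZ IH hq' sy_D sy_Z.
have [c c0 hc] := Ap (enum 'I_r); have [q hq] := Aq p.
exists (c^-1 *: q); rewrite sy_Z -hq hc scalerA mulVf //.
by rewrite scale1r.
Qed.

Definition block_poly i : {poly OX} :=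
  \prod_(l | blk l == i) ('X - ('X_l : OX)%:P).

Lemma block_poly_symmetric i j : block_symmetric i (block_poly i)`_j.
Proof.
split=> [|s sB].
  have supp_nat (B : {set 'I_n}) (b : bool) : supported B (b%:R : OX).
    by rewrite -(rmorph_nat (@mpolyC n F)); apply: supportedC.
  move: j; apply: (big_ind (fun P : {poly OX} => forall j, supported (block i) P`_j)).
  - by move=> j; rewrite coef1.
  - move=> P Q hP hQ j; rewrite coefM.
    apply: big_ind => [||l _]; first exact: (supp_nat _ false).
      exact: supportedD.
    exact: supportedM.
  move=> l li j; rewrite coefB coefX coefC; apply: supportedD => //.
  rewrite -mulN1r -(rmorphN1 (@mpolyC n F)); apply: supportedM.
    exact: supportedC.
  case: (j == 0%N); last exact: (supp_nat _ false).
  apply: supportedX => k; rewrite inE mnm1E => kB.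
  by case: eqP => // lk; rewrite -lk li in kB.
rewrite -coef_map.
suff -> : map_poly (msym s) (block_poly i) = block_poly i by [].
rewrite /block_poly rmorph_prod /= [RHS](reindex_inj (@perm_inj _ s)) /=.
have /stabP[_ sG] := perm_on_block sB.
apply: eq_big => l; first by rewrite sG.
by rewrite rmorphB /= map_polyX map_polyC /= msymXU.
Qed.

(** Let Q be the block polynomial of x. Applying E to Q (x) = 0 leaves
    Q' (x) * E x = 0, and Q' (x) <> 0 because the roots are distinct. *)
Lemma derivation_eq0 (K : idomainType) (t : {rmorphism OX -> K}) (E : OX -> K) :
    injective t -> (forall p q, E (p + q) = E p + E q) ->
    (forall p q, E (p * q) = E p * t q + t p * E q) ->
    (forall q, E (sy q) = 0) ->
  forall p, E p = 0.
Proof.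
move=> t_inj ED EM Esy.
have Ehorner (Q : {poly OX}) x : (forall j, E Q`_j = 0) ->
    E Q.[x] = t (Q^`()).[x] * E x.
  elim/poly_ind: Q => [|Q c IH] hQ.
    by have := hQ 0%N; rewrite coefC /= derivC !horner0 rmorph0 mul0r.
  have hc : E c = 0 by have := hQ 0%N; rewrite coefD coefMX coefC /= add0r.
  have {}IH : E Q.[x] = t (Q^`()).[x] * E x.
    by apply: IH => j; have := hQ j.+1; rewrite coefD coefMX coefC /= addr0.
  rewrite derivMXaddC !hornerE ED EM IH hc addr0 rmorphD rmorphM.
  by rewrite mulrDl mulrAC addrC.
elim/mpoly_alg_ind => [c|k|p q hp hq|p q hp hq].
- by rewrite -sy_C.
- have hP j : E (block_poly (blk k))`_j = 0.
    by have [q ->] := y_gen (block_poly_symmetric (blk k) j); apply: Esy.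
  have := Ehorner (block_poly (blk k)) 'X_k hP.
  have Pk : block_poly (blk k) = ('X - ('X_k)%:P) *
      \prod_(l | (blk l == blk k) && (l != k)) ('X - ('X_l : OX)%:P).
    by rewrite /block_poly (bigD1 k) //=.
  rewrite {1 2}Pk hornerM hornerXsubC subrr mul0r.
  rewrite derivM derivXsubC mul1r hornerD [X in _ + X]hornerM hornerXsubC.
  rewrite subrr mul0r addr0.
  have -> : E 0 = 0 by apply: (addrI (E 0)); rewrite -ED !addr0.
  move/esym/eqP; rewrite mulf_eq0 -{1}(rmorph0 t) (inj_eq t_inj) => /orP[|/eqP //].
  rewrite horner_prod prodf_seq_eq0 => /hasP[l _ /andP[/andP[_ lk]]].
  rewrite hornerXsubC subr_eq0 => /eqP/(congr1 (mcoeff U_(k))).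
  by rewrite !mcoeffXU eqxx (negPf lk) => /eqP; rewrite oner_eq0.
- by rewrite ED hp hq addr0.
- by rewrite EM hp hq mul0r mulr0 addr0.
Qed.

Lemma mderivXU (j l : 'I_n) : ('X_j : OX)^`M(l) = (j == l)%:R.
Proof.
rewrite mderivX mnm1E; case: eqP => [->|_]; last by rewrite scale0r.
rewrite scale1r -mpolyX0; congr 'X_[_]; apply/mnmP => k.
by rewrite mnmBE subnn mnm0E.
Qed.

Lemma mderiv_sy k q : (sy q)^`M(k) = \sum_j (y j)^`M(k) * sy q^`M(j).
Proof.
elim/mpoly_alg_ind: q => [c|j|p q hp hq|p q hp hq].
- by rewrite sy_C mderivC big1 // => j _; rewrite mderivC sy_0 mulr0.
- rewrite sy_X (bigD1 j) //= mderivXU eqxx sy_1 mulr1 big1 ?addr0 // => l lj.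
  by rewrite mderivXU eq_sym (negPf lj) sy_0 mulr0.
- by rewrite sy_D mderivD hp hq -big_split; apply: eq_bigr => j _;
    rewrite mderivD sy_D mulrDr.
- rewrite sy_M mderivM hp hq mulr_suml mulr_sumr -big_split.
  apply: eq_bigr => j _; rewrite mderivM sy_D !sy_M mulrDr.
  by congr (_ + _); rewrite ?mulrA // -mulrA mulrCA mulrA.
Qed.

Lemma mderiv_eq0 (p : OX) : (forall k, p^`M(k) = 0) -> p = (p@_0%MM)%:MP.
Proof.
move=> h; apply/mpolyP => m; rewrite mcoeffC; case: eqP => [->|/eqP m0].
  by rewrite mulr1.
rewrite mulr0; have /existsP[k mk] : [exists k, m k != 0%N].
  apply: contraNT m0 => /existsPn h0; apply/eqP/mnmP => k.
  by have := h0 k; rewrite negbK mnm0E => /eqP.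
have := congr1 (mcoeff (m - U_(k))%MM) (h k).
rewrite mcoeff_deriv mcoeff0 submK; last by rewrite lep1mP.
by move/eqP; rewrite mulrn_eq0 /= => /eqP.
Qed.

Lemma msize_mderiv (p : OX) k : (msize p^`M(k) <= (msize p).-1)%N.
Proof.
rewrite msizeE; apply/bigmax_leqP_seq => m + _; rewrite mcoeff_msupp mcoeff_deriv.
have [->|nz _] := eqVneq (p@_(m + U_(k))) 0; first by rewrite mul0rn eqxx.
rewrite -mcoeff_msupp in nz; have := msize_mdeg_lt nz.
by rewrite mdegD mdeg1 addn1; case: (msize p).
Qed.

End Coordinates.

(** * Derivations of the cover *)

Section Cover.

Variables (F : numFieldType) (n r : nat) (blk : 'I_n -> 'I_r).

Local Notation OX := {mpoly F[n]}.
Local Notation G := (stab blk [set: 'I_n]).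

Variable y : 'I_n -> OX.
Hypothesis y_sym : forall j, block_symmetric blk (blk j) (y j).
Hypothesis y_gen : forall i p, block_symmetric blk i p ->
  exists q, p = q \mPo [tuple y j | j < n].

(* The regular functions of the cover are the fractions with a power of disc as
   denominator; t is the embedding of the polynomials. *)
Variables (K : fieldType) (t : {rmorphism OX -> K}) (disc : OX).
Hypothesis t_inj : injective t.
Hypothesis disc_neq0 : disc != 0.

Variable OU : K -> Prop.
Hypothesis OU_poly : forall p, OU (t p).
Hypothesis OU_den : forall u, OU u -> exists p m, u * t disc ^+ m = t p.

Variable act : 'S_n -> {rmorphism K -> K}.
Hypothesis actM : forall (s s' : 'S_n) u, act (s * s')%g u = act s' (act s u).
Hypothesis act1 : forall u, act 1%g u = u.
Hypothesis act_poly : forall s p, act s (t p) = t (msym s p).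
Hypothesis OU_act : forall s u, s \in G -> OU u -> OU (act s u).

Variable dy : 'I_n -> K -> K.
Hypothesis dyD : forall j u v, OU u -> OU v -> dy j (u + v) = dy j u + dy j v.
Hypothesis dyM : forall j u v, OU u -> OU v ->
  dy j (u * v) = dy j u * v + u * dy j v.
Hypothesis dy_sy : forall j q, dy j (t (sy y q)) = t (sy y q^`M(j)).

Lemma dy_scalar j c : dy j (t c%:MP) = 0.
Proof. by rewrite -(sy_C y) dy_sy mderivC sy_0 rmorph0. Qed.

(** The derivative in x_k, expressed through the derivatives in the invariants
    by the chain rule. *)
Definition Dx k (u : K) : K := \sum_j t (y j)^`M(k) * dy j u.

Lemma DxM k u v : OU u -> OU v -> Dx k (u * v) = Dx k u * v + u * Dx k v.
Proof.
move=> hu hv; rewrite /Dx mulr_suml mulr_sumr -big_split /=; apply: eq_bigr => j _.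
by rewrite dyM // mulrDr mulrA [t _ * (u * _)]mulrCA.
Qed.

Lemma Dx_poly k p : Dx k (t p) = t p^`M(k).
Proof.
apply/eqP; rewrite -subr_eq0; apply/eqP.
apply: (derivation_eq0 y_gen (E := fun p => Dx k (t p) - t p^`M(k)) t_inj).
- move=> p1 p2; rewrite !(mderivD, rmorphD) opprD addrACA; congr (_ + _).
  by rewrite /Dx -big_split /=; apply: eq_bigr => j _; rewrite dyD // mulrDr.
- move=> p1 p2; rewrite rmorphM DxM // mderivM rmorphD !rmorphM opprD addrACA.
  by rewrite mulrBl mulrBr.
- move=> q; apply/eqP; rewrite subr_eq0 mderiv_sy [X in _ == X]rmorph_sum; apply/eqP.
  by rewrite /Dx; apply: eq_bigr => j _; rewrite dy_sy rmorphM.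
Qed.

(** The conjugate of dy j by s is another derivation extending the derivative of
    the base, so both agree on polynomials, and then on their fractions. *)
Lemma dy_act j s u : s \in G -> OU u -> dy j (act s u) = act s (dy j u).
Proof.
move=> sG; have s'G : (s^-1 \in G)%g by rewrite groupV.
have actK w : act s^-1%g (act s w) = w by rewrite -actM mulgV act1.
have actVK w : act s (act s^-1%g w) = w by rewrite -actM mulVg act1.
have dyp p : dy j (act s (t p)) = act s (dy j (t p)).
  have : act s^-1%g (dy j (act s (t p))) - dy j (t p) = 0.
    apply: (derivation_eq0 y_gen
      (E := fun p => act s^-1%g (dy j (act s (t p))) - dy j (t p)) t_inj).
    + move=> p1 p2; rewrite rmorphD [act s (_ + _)]rmorphD.
      by rewrite !dyD ?act_poly // [act _ (_ + _)]rmorphD opprD addrACA.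
    + move=> p1 p2; rewrite rmorphM [act s (_ * _)]rmorphM.
      rewrite !dyM ?[act s (t _)]act_poly // rmorphD !rmorphM.
      rewrite -!act_poly !actK.
      by rewrite opprD addrACA mulrBl mulrBr.
    move=> q; rewrite act_poly (sy_invariant y_sym _ sG) dy_sy act_poly.
    by rewrite (sy_invariant y_sym _ s'G) subrr.
  by move/eqP; rewrite subr_eq0 => /eqP <-; rewrite actVK.
move=> hu; have [p [m up]] := OU_den hu; pose q := disc ^+ m.
have uq : u * t q = t p by rewrite /q rmorphXn.
have q0 : act s (t q) != 0.
  by rewrite fmorph_eq0 -(rmorph0 t) (inj_eq t_inj) expf_neq0.
apply: (mulIf q0); apply: (addIr (act s u * dy j (act s (t q)))).
rewrite -dyM ?act_poly //; last exact: OU_act.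
by rewrite -act_poly -rmorphM uq !dyp -!rmorphM -rmorphD -dyM // uq.
Qed.

Lemma nonconstant_mderiv (p : OX) : (1 < msize p)%N -> exists k, p^`M(k) != 0.
Proof.
move=> p1; have [/forallP h|/forallPn [k hk]] := boolP [forall k, p^`M(k) == 0].
  suff : (msize p <= 1)%N by rewrite leqNgt p1.
  by rewrite (mderiv_eq0 (fun k => eqP (h k))) msizeC; case: eqP.
by exists k.
Qed.

Lemma msize_mderiv_lt (p : OX) k : (1 < msize p)%N ->
  (msize p^`M(k) < msize p)%N.
Proof. by move=> p1; have := msize_mderiv p k; case: (msize p) p1. Qed.

(** Such a u is a polynomial: write u * q = p with q of least degree; a derivative
    of this equality is again of the same form, because u has derivative 0. *)
Lemma dy_const u : OU u -> (forall j, dy j u = 0) -> exists c, u = t c%:MP.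
Proof.
move=> hu u0; have Dx0 k : Dx k u = 0.
  by apply: big1 => j _; rewrite u0 mulr0.
suff [p up] : exists p, u = t p.
  exists p@_0%MM; rewrite up; congr (t _); apply: mderiv_eq0 => k.
  by apply: t_inj; rewrite -Dx_poly -up Dx0 rmorph0.
have [p0 [m up0]] := OU_den hu; rewrite -rmorphXn in up0.
move: (disc ^+ m) (expf_neq0 m disc_neq0) p0 up0 => q q0 p up.
have [N le_qN] := ubnP (msize q); elim: N q q0 p up le_qN => // N IH q q0 p up.
rewrite ltnS => le_qN; case: (leqP (msize q) 1) => [|q1].
  move/msize1_polyC => qC; have c0 : q@_0%MM != 0.
    by apply: contraNneq q0 => c0; rewrite qC c0 mpolyC0.
  exists (p * (q@_0%MM)^-1%:MP); rewrite rmorphM -up {1}qC -mulrA -rmorphM.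
  by rewrite -mpolyCM divff // mpolyC1 rmorph1 mulr1.
have [k hk] := nonconstant_mderiv q1.
apply: (IH q^`M(k) hk p^`M(k)); last exact: leq_trans (msize_mderiv_lt k q1) le_qN.
by rewrite -!Dx_poly -up DxM // Dx0 mul0r add0r.
Qed.

Local Notation DU := (DU OU dy).

Lemma DU_Dx k : exists2 T, DU T & forall u, T u = Dx k u.
Proof.
rewrite /Dx; elim: (index_enum _) => [|j s [T hT eT]].
  exists (fun u => t 0 * u); first exact: DU_mul (OU_poly 0) (DU_id _ _).
  by move=> u; rewrite rmorph0 mul0r big_nil.
exists (fun u => t (y j)^`M(k) * dy j u + T u); last first.
  by move=> u; rewrite big_cons eT.
by apply: DU_add hT; apply: DU_mul (OU_poly _) _; apply: DU_dy; apply: DU_id.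
Qed.

(** Clear the denominator, then differentiate down to a nonzero constant. *)
Lemma DU_unit u : OU u -> u != 0 -> exists2 T, DU T & T u = 1.
Proof.
move=> hu u0; have [p [m up]] := OU_den hu.
have p0 : p != 0.
  rewrite -(inj_eq t_inj) -up rmorph0 mulf_neq0 // expf_neq0 //.
  by rewrite -(rmorph0 t) (inj_eq t_inj).
suff [T hT Tp] : exists2 T, DU T & T (t p) = 1.
  exists (fun w => T (t (disc ^+ m) * w)); last by rewrite rmorphXn mulrC up.
  by apply: (DU_comp hT); apply: DU_mul (OU_poly _) (DU_id _ _).
have [N le_pN] := ubnP (msize p); elim: N p p0 {up} le_pN => // N IH p p0.
rewrite ltnS => le_pN; case: (leqP (msize p) 1) => [|p1].
  move/msize1_polyC => pC; have c0 : p@_0%MM != 0.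
    by apply: contraNneq p0 => c0; rewrite pC c0 mpolyC0.
  exists (fun w => t (p@_0%MM)^-1%:MP * w); first exact: DU_mul (OU_poly _) (DU_id _ _).
  by rewrite {2}pC -rmorphM -mpolyCM mulVf // mpolyC1 rmorph1.
have [k hk] := nonconstant_mderiv p1; have [D hD eD] := DU_Dx k.
have [|T hT Tp] := IH _ hk; first exact: leq_trans (msize_mderiv_lt k p1) le_pN.
by exists (fun w => T (D w)); [apply: DU_comp | rewrite eD Dx_poly].
Qed.

Variable DV : (K -> K) -> Prop.
Hypothesis DV_scalar : forall c, DV (fun u => t c%:MP * u).
Hypothesis DV_y : forall j, DV (fun u => t (y j) * u).
Hypothesis DV_invdisc2 : DV (fun u => (t disc ^+ 2)^-1 * u).
Hypothesis DV_add : forall P Q, DV P -> DV Q -> DV (fun u => P u + Q u).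
Hypothesis DV_comp : forall P Q, DV P -> DV Q -> DV (fun u => P (Q u)).
Hypothesis disc2_inv : forall s, s \in G -> msym s (disc ^+ 2) = disc ^+ 2.

Lemma DV_sy q : exists2 P, DV P & forall u, P u = t (sy y q) * u.
Proof.
elim/mpoly_alg_ind: q => [c|j|p q [P hP eP] [Q hQ eQ]|p q [P hP eP] [Q hQ eQ]].
- by exists (fun u => t c%:MP * u) => // u; rewrite sy_C.
- by exists (fun u => t (y j) * u) => // u; rewrite sy_X.
- exists (fun u => P u + Q u); first exact: DV_add.
  by move=> u; rewrite eP eQ sy_D rmorphD mulrDl.
- exists (fun u => P (Q u)); first exact: DV_comp.
  by move=> u; rewrite eP eQ sy_M rmorphM mulrA.
Qed.

(** An even power of the discriminant is an invariant denominator. *)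
Lemma DV_invariant a : OU a -> (forall s, s \in G -> act s a = a) ->
  exists2 P, DV P & forall u, OU u -> P u = a * u.
Proof.
move=> ha a_inv; have [p [m ap]] := OU_den ha.
have d0 : t disc != 0 by rewrite -(rmorph0 t) (inj_eq t_inj).
have aq : a * t disc ^+ 2 ^+ m = t (p * disc ^+ m).
  by rewrite rmorphM rmorphXn -ap exprAC expr2 mulrA.
have [s sG|q hq] := invariant_sy y_sym y_gen (p := p * disc ^+ m).
  apply: t_inj; rewrite -act_poly -aq rmorphM a_inv //; congr (_ * _).
  have -> : t disc ^+ 2 ^+ m = t ((disc ^+ 2) ^+ m) by rewrite !rmorphXn.
  by rewrite act_poly [msym s _]rmorphXn /= disc2_inv.
have [Q hQ eQ] := DV_sy q.
suff [P hP eP] : exists2 P, DV P & forall u, P u = (t disc ^+ 2 ^+ m)^-1 * u.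
  exists (fun u => P (Q u)); first exact: DV_comp.
  move=> u _; rewrite eP eQ mulrA; congr (_ * _).
  by rewrite -hq -aq mulrC mulfK // !expf_neq0.
elim: m {ap aq hq} => [|m [P hP eP]].
  exists (fun u => t 1%:MP * u); first exact: DV_scalar.
  by move=> u; rewrite mpolyC1 rmorph1 expr0 invr1.
exists (fun u => (t disc ^+ 2)^-1 * P u); first exact: (DV_comp DV_invdisc2).
by move=> u; rewrite eP mulrA -invfM -exprS.
Qed.

End Cover.

(** * The Specht monomial *)

Section SpechtMonomial.

Variables (F : numFieldType) (n : nat) (I : eqType).
Variables (comp : 'I_n -> I) (row col : 'I_n -> nat) (e : 'I_n -> nat).
Hypothesis box_inj : forall k l,
  comp k = comp l -> row k = row l -> col k = col l -> k = l.
Hypothesis e_row : forall k l, comp k = comp l -> row k = row l -> e k = e l.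
Hypothesis row_e : forall k l, comp k = comp l -> e k = e l -> row k = row l.

(** The row group fixes the monomial; an element of the column group fixing it
    preserves the rows too, so only the identity contributes to the coefficient
    of the monomial. *)
Lemma young_monomial_neq0 :
  \sum_(s in stab (fun k => (comp k, row k)) [set: 'I_n])
    \sum_(t in stab (fun k => (comp k, col k)) [set: 'I_n])
      (-1) ^+ odd_perm t * msym t (msym s 'X_[ [multinom e k | k < n] ])
  != 0 :> {mpoly F[n]}.
Proof.
set m := [multinom e k | k < n].
have row_fix s : s \in stab (fun k => (comp k, row k)) [set: 'I_n] ->
    msym s 'X_[m] = 'X_[m] :> {mpoly F[n]}.
  move=> /groupVr /row_groupP sR; rewrite msymX; congr 'X_[_].
  by apply/mnmP => k; rewrite !mnmE; have [c1 c2] := sR k; apply: e_row.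
rewrite (eq_bigr (fun=> \sum_(t in stab (fun k => (comp k, col k)) [set: 'I_n])
      (-1) ^+ odd_perm t * msym t 'X_[m])); last first.
  by move=> s sR; apply: eq_bigr => t _; rewrite row_fix.
rewrite sumr_const -mulr_natl mulf_neq0 //.
  by rewrite -(rmorph_nat (@mpolyC n F)) mpolyC_eq0 pnatr_eq0 -lt0n cardG_gt0.
apply/eqP => /(congr1 (mcoeff m)); rewrite mcoeff0 raddf_sum /=.
rewrite (bigD1 1%g) ?group1 //= odd_perm1 expr0 mul1r msym1m mcoeffX eqxx.
rewrite big1 ?addr0; first by move/eqP; rewrite oner_eq0.
move=> t /andP[tC t1]; rewrite msymX -(rmorph_sign (@mpolyC n F)) mcoeffCM mcoeffX.
case: eqP => [tm|]; last by rewrite mulr0.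
case/eqP: t1; apply/invg_inj; rewrite invg1; have {}tC := groupVr tC.
apply: (row_col_id box_inj (s := t^-1%g)) => //.
apply/row_groupP => k; have /col_groupP/(_ k) [ck _] := tC; split=> //.
by apply: row_e => //; have /mnmP/(_ k) := tm; rewrite !mnmE.
Qed.

End SpechtMonomial.

(** * The function field and the localization at the discriminant *)

Local Notation "p %:F" := (@FracField.tofrac _ p).

Section Localization.

Variables (R : realType) (r : nat) (d : 'I_r -> nat).

Local Notation n := (nvars d).
Local Notation C := (R[i]).
Local Notation OX := {mpoly C[n]}.
Local Notation K := {fraction OX}.

Local Notation tofrac := (@FracField.tofrac OX).

Definition scal : C -> K := tofrac \o @mpolyC n C.
HB.instance Definition _ :=
  GRing.RMorphism.copy scal (tofrac \o @mpolyC n C).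

Lemma sact_poly (s : 'S_n) (p : OX) : sact s p%:F = (msym s p)%:F.
Proof.
have := sactE s p (oner_neq0 OX).
by rewrite !rmorph1 !divr1.
Qed.

Lemma fracB (p q p' q' : OX) : q != 0 -> q' != 0 ->
  p%:F / q%:F - p'%:F / q'%:F = (p * q' - p' * q)%:F / (q * q')%:F.
Proof.
move=> q0 q0'; rewrite -mulNr addf_div ?tofrac_eq0 //.
by rewrite (rmorphB tofrac) !(rmorphM tofrac) mulNr.
Qed.

Lemma fracM (p q p' q' : OX) :
  (p%:F / q%:F) * (p'%:F / q'%:F) = (p * p')%:F / (q * q')%:F.
Proof. by rewrite mulf_div !(rmorphM tofrac). Qed.

Lemma msym_neq0 (s : 'S_n) (p : OX) : p != 0 -> msym s p != 0.
Proof. by rewrite -(inj_eq (@inj_msym _ _ s)) msym0. Qed.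

Lemma fracP (u : K) : exists p q : OX, q != 0 /\ u = p%:F / q%:F.
Proof.
exists (\n_(generic_quotient.repr u)), (\d_(generic_quotient.repr u)).
by split; [exact: denom_ratioP | exact: frac_repr].
Qed.

Lemma sact_additive (s : 'S_n) : zmod_morphism (@sact r d R s).
Proof.
move=> u v; have [p [q [q0 ->]]] := fracP u; have [p' [q' [q0' ->]]] := fracP v.
rewrite (fracB _ _ q0 q0') (sactE _ _ (mulf_neq0 q0 q0')).
rewrite (sactE _ _ q0) (sactE _ _ q0') fracB ?msym_neq0 //.
by rewrite msymB !msymM.
Qed.

Lemma sact_multiplicative (s : 'S_n) : monoid_morphism (@sact r d R s).
Proof.
split=> [|u v]; first by rewrite -(rmorph1 tofrac) sact_poly msym1.
have [p [q [q0 ->]]] := fracP u; have [p' [q' [q0' ->]]] := fracP v.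
rewrite fracM (sactE _ _ (mulf_neq0 q0 q0')) (sactE _ _ q0) (sactE _ _ q0').
by rewrite fracM !msymM.
Qed.

HB.instance Definition _ (s : 'S_n) :=
  GRing.isZmodMorphism.Build K K (@sact r d R s) (sact_additive s).
HB.instance Definition _ (s : 'S_n) :=
  GRing.isMonoidMorphism.Build K K (@sact r d R s) (sact_multiplicative s).

Lemma sact1 (u : K) : sact 1%g u = u.
Proof.
by have [p [q [q0 ->]]] := fracP u; rewrite (sactE _ _ q0) !msym1m.
Qed.

Lemma sactM (s t : 'S_n) (u : K) : sact (s * t)%g u = sact t (sact s u).
Proof.
have [p [q [q0 ->]]] := fracP u; rewrite (sactE _ _ q0) (sactE _ _ q0).
by rewrite (sactE _ _ (msym_neq0 s q0)) !msymMm.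
Qed.

Lemma sact_scal (s : 'S_n) c : sact s (scal c) = scal c.
Proof.
rewrite /scal /= sact_poly; congr (_ %:F).
by rewrite -[_%:MP]mulr1 mul_mpolyC msymZ msym1.
Qed.

Lemma Delta_neq0 : Delta d R != 0.
Proof.
apply/prodf_neq0 => i _; apply/prodf_neq0 => k _; apply/prodf_neq0 => l.
case/andP => _ kl; apply/eqP => /(congr1 (mcoeff U_(k))).
rewrite mcoeffB !mcoeffXU mcoeff0 eqxx; case: eqP => [lk|_].
  by rewrite lk ltnn in kl.
by rewrite subr0 => /eqP; rewrite oner_eq0.
Qed.

Local Notation DeltaF := ((Delta d R)%:F).

Lemma DeltaF_neq0 m : DeltaF ^+ m != 0.
Proof. by rewrite expf_neq0 // tofrac_eq0 Delta_neq0. Qed.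

Lemma OU_poly (p : OX) : OU p%:F.
Proof. by exists p, 0%N; rewrite expr0 divr1. Qed.

Lemma OUD (u v : K) : OU u -> OU v -> OU (u + v).
Proof.
move=> [p [m ->]] [q [l ->]].
exists (p * Delta d R ^+ l + q * Delta d R ^+ m), (m + l)%N.
rewrite addf_div ?DeltaF_neq0 // exprD (rmorphD tofrac) !(rmorphM tofrac).
by rewrite !(rmorphXn tofrac).
Qed.

Lemma OUM (u v : K) : OU u -> OU v -> OU (u * v).
Proof.
move=> [p [m ->]] [q [l ->]]; exists (p * q), (m + l)%N.
by rewrite mulf_div exprD (rmorphM tofrac).
Qed.

Lemma OU0 : OU (0 : K). Proof. by rewrite -(rmorph0 tofrac); apply: OU_poly. Qed.
Lemma OU_scal c : OU (scal c). Proof. exact: OU_poly. Qed.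

Lemma OU_invDelta m : OU (DeltaF ^+ m)^-1.
Proof. by exists 1, m; rewrite (rmorph1 tofrac) mul1r. Qed.

Variable blk : 'I_n -> 'I_r.
Hypothesis blkP : forall i k, (k \in block d i) = (blk k == i).

Local Notation G := (stab blk [set: 'I_n]).

Lemma blk_perm (s : 'S_n) k : s \in G -> blk (s k) = blk k.
Proof. by move=> /stabP[_ ->]. Qed.

(** Up to sign, the square is the product of the differences over all ordered pairs of
    distinct variables of a block, which the group only permutes. *)
Lemma Delta2_inv (s : 'S_n) : s \in G -> msym s (Delta d R ^+ 2) = Delta d R ^+ 2.
Proof.
move=> sG; pose f (k l : 'I_n) : OX := 'X_k - 'X_l.
have DE : Delta d R =
    \prod_k \prod_(l | (blk l == blk k) && (k < l)%N) f k l.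
  rewrite (partition_big blk predT) //=; apply: eq_bigr => i _.
  apply: eq_big => [k|k]; first exact: blkP.
  by rewrite blkP => /eqP <-; apply: eq_bigl => l; rewrite blkP.
pose c : OX := \prod_(k : 'I_n) \prod_(l | (blk l == blk k) && (k < l)%N) (-1).
have c0 : c != 0.
  by apply/prodf_neq0 => k _; apply/prodf_neq0 => l _; rewrite oppr_eq0 oner_neq0.
have sc : msym s c = c.
  by rewrite /c !rmorph_prod; apply: eq_bigr => k _; rewrite rmorph_prod;
    apply: eq_bigr => l _; rewrite rmorphN1.
pose X2 : OX := \prod_k \prod_(l | (blk l == blk k) && (l != k)) f k l.
have sX2 : msym s X2 = X2.
  rewrite /X2 !rmorph_prod [RHS](reindex_inj (@perm_inj _ s)) /=.
  apply: eq_bigr => k _; rewrite rmorph_prod [RHS](reindex_inj (@perm_inj _ s)) /=.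
  apply: eq_big => l; first by rewrite !blk_perm // (inj_eq perm_inj).
  by move=> _; rewrite /f msymB !msymXU.
have X2E : X2 = c * Delta d R ^+ 2.
  have -> : X2 = Delta d R *
      \prod_k \prod_(l | (blk l == blk k) && (l < k)%N) f k l.
    rewrite DE -big_split /=; apply: eq_bigr => k _.
    rewrite (bigID (fun l : 'I_n => (k < l)%N)) /=; congr (_ * _);
      apply: eq_bigl => l; rewrite -andbA; congr (_ && _).
      by case: eqP => [->|]; rewrite ?ltnn ?andbT.
    by rewrite -leqNgt ltn_neqAle.
  rewrite expr2 mulrCA; congr (_ * _); rewrite {1}DE /c.
  rewrite (exchange_big_dep predT) //= -big_split /=; apply: eq_bigr => k _.
  rewrite -big_split /=; apply: eq_big => l; first by rewrite eq_sym.
  by rewrite mulN1r /f opprB.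
by apply: (mulfI c0); rewrite -{1}sc -msymM -X2E sX2.
Qed.

Lemma OU_sact (s : 'S_n) (u : K) : s \in G -> OU u -> OU (sact s u).
Proof.
move=> sG [p [m ->]]; exists (msym s (p * Delta d R ^+ m)), (m * 2)%N.
have -> : p%:F / DeltaF ^+ m = (p * Delta d R ^+ m)%:F / (Delta d R ^+ (m * 2))%:F.
  rewrite (rmorphM tofrac) !(rmorphXn tofrac) muln2 -addnn exprD invfM mulrACA.
  by rewrite divff ?DeltaF_neq0 // mulr1.
rewrite (sactE _ _ (expf_neq0 _ Delta_neq0)) -(rmorphXn tofrac); congr (_ / _).
by rewrite mulnC exprM (rmorphXn (msym s)) /= Delta2_inv.
Qed.

End Localization.

(** * Positions in a natural standard tableau *)

Section Tableau.

Variables (r : nat) (d : 'I_r -> nat) (la : 'I_r -> seq nat).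
Hypothesis hla : is_rdiagram d la.
Variable T : rtableau d la.
Arguments T : clear implicits.
Hypothesis hT : is_natural T.

Local Notation n := (nvars d).

Definition to_rbox i (b : box (la i)) : rbox la :=
  Tagged (fun i => box (la i) : Type) b.

Lemma entry_inj : injective (entry T).
Proof.
case: hT => -[h1 _] _ b b' e; have /eqP/cards1P[c hc] := h1 (entry T b).
have : b \in [set b0 | entry T b0 == entry T b] by rewrite inE.
have : b' \in [set b0 | entry T b0 == entry T b] by rewrite inE e.
by rewrite hc !inE => /eqP-> /eqP->.
Qed.

Lemma box_exists k : exists b, entry T b == k.
Proof.
case: hT => -[h1 _] _; have /eqP/cards1P[c hc] := h1 k; exists c.
by have := set11 c; rewrite -hc inE.
Qed.

Definition box_of k : rbox la := xchoose (box_exists k).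

Lemma box_ofK : cancel box_of (entry T).
Proof. by move=> k; apply/eqP; apply: (xchooseP (box_exists k)). Qed.

Lemma entryK : cancel (entry T) box_of.
Proof. by move=> b; apply: entry_inj; rewrite box_ofK. Qed.

Definition comp_of k : 'I_r := tag (box_of k).
Definition row_of k : nat := brow (tagged (box_of k)).
Definition col_of k : nat := bcol (tagged (box_of k)).

Lemma box_eq (sh : seq nat) (b b' : box sh) :
  brow b = brow b' -> bcol b = bcol b' -> b = b'.
Proof.
case: b b' => [i j] [i' j']; rewrite /brow /bcol /= => /val_inj ii.
by case: i' / ii j' => j' /val_inj ->.
Qed.

Lemma comp_entry i (b : box (la i)) : comp_of (T i b) = i.
Proof. by rewrite /comp_of -[T i b]/(entry T (to_rbox b)) entryK. Qed.

Lemma row_entry i (b : box (la i)) : row_of (T i b) = brow b.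
Proof. by rewrite /row_of -[T i b]/(entry T (to_rbox b)) entryK. Qed.

Lemma col_entry i (b : box (la i)) : col_of (T i b) = bcol b.
Proof. by rewrite /col_of -[T i b]/(entry T (to_rbox b)) entryK. Qed.

Lemma entry_of k : exists b : box (la (comp_of k)), k = T (comp_of k) b.
Proof. by exists (tagged (box_of k)); rewrite -{1}(box_ofK k). Qed.

Lemma box_of_inj k l : comp_of k = comp_of l -> row_of k = row_of l ->
  col_of k = col_of l -> k = l.
Proof.
have [b ->] := entry_of k; have [b' ->] := entry_of l.
move: (comp_of k) (comp_of l) b b' => i j b b'.
rewrite !comp_entry !row_entry !col_entry => ij.
by case: j / ij b' => b' r1 r2; rewrite (box_eq r1 r2).
Qed.

Lemma shape_antimono i j l : (j <= l)%N -> (l < size (la i))%N ->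
  (nth 0%N (la i) l <= nth 0%N (la i) j)%N.
Proof.
move=> jl ls; have /and3P[srt _ _] := hla i.
have tr : transitive geq by move=> a b c ba ac; apply: leq_trans ac ba.
by apply: (sorted_leq_nth tr (@leqnn) 0%N srt) => //; rewrite inE //; apply: leq_ltn_trans ls.
Qed.

Lemma box_of_closed k i : (i <= row_of k)%N ->
  exists l, [/\ comp_of l = comp_of k, row_of l = i & col_of l = col_of k].
Proof.
have [b kb] := entry_of k; move: (comp_of k) b kb => c b ->.
rewrite row_entry col_entry; case: b => [a m] /= ia.
have a_lt := ltn_ord a; have m_lt := ltn_ord m.
have i_lt : (i < size (la c))%N by apply: leq_ltn_trans a_lt.
have mi : (m < nth 0%N (la c) (Ordinal i_lt))%N.
  by apply: leq_trans m_lt _; apply: shape_antimono.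
pose b : box (la c) := Tagged (fun i : 'I__ => 'I_(nth 0%N (la c) i)) (Ordinal mi).
by exists (T c b); rewrite comp_entry row_entry col_entry.
Qed.

Lemma block_comp i k : (k \in block d i) = (comp_of k == i).
Proof.
case: hT => _ /(_ i) <-; apply/imsetP/eqP => [[b _ ->]|<-].
  exact: comp_entry.
by have [b kb] := entry_of k; exists b.
Qed.

Lemma position_stabE i (f : box (la i) -> nat) (g : 'I_n -> nat) :
    (forall b, g (T i b) = f b) ->
  [set s : 'S_n | perm_on [set T i b | b : box (la i)] s &&
    [forall b, [exists b', (f b' == f b) && (s (T i b) == T i b')]]] =
  stab (fun k => (comp_of k, g k)) [set k | comp_of k == i].
Proof.
move=> gE; have imT : [set T i b | b : box (la i)] = [set k | comp_of k == i].
  by case: hT => _ ->; apply/setP => k; rewrite block_comp inE.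
apply/setP => s; rewrite inE imT; apply/andP/stabP => -[sB h]; split=> //.
  move=> k; have [kB|kB] := boolP (k \in [set k | comp_of k == i]); last first.
    by rewrite (out_perm sB).
  move: (kB); rewrite -imT => /imsetP[b _ ->].
  have /forallP/(_ b)/existsP[b' /andP[/eqP fb /eqP ->]] := h.
  by rewrite !comp_entry !gE fb.
apply/forallP => b; have [sc sg] := h (T i b).
have : s (T i b) \in [set T i b | b : box (la i)].
  by rewrite imT inE sc comp_entry.
case/imsetP => b' _ e; apply/existsP; exists b'; rewrite e eqxx andbT.
by rewrite -!gE -e sg.
Qed.

Lemma row_stabE i : row_stab (T i) =
  stab (fun k => (comp_of k, row_of k)) [set k | comp_of k == i].
Proof. exact: position_stabE (@row_entry i). Qed.

Lemma col_stabE i : col_stab (T i) =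
  stab (fun k => (comp_of k, col_of k)) [set k | comp_of k == i].
Proof. exact: position_stabE (@col_entry i). Qed.

Lemma offset_block_le (i : 'I_r) : (offset d i + d i <= n)%N.
Proof.
rewrite /nvars /offset [leqRHS](bigID (fun j : 'I_r => (j < i)%N)) /=.
by rewrite leq_add2l (bigD1 i) ?ltnn //= leq_addr.
Qed.

Lemma sumn_shape i : sumn (la i) = d i.
Proof. by have /and3P[_ _ /eqP] := hla i. Qed.

(** The component of T on a block, renumbered from 0, is a standard tableau. *)
Lemma nb_std_gt0 i : (0 < nb_std (la i))%N.
Proof.
have Tblock b : (offset d i <= T i b < offset d i + d i)%N.
  have : T i b \in block d i by rewrite block_comp comp_entry.
  by rewrite inE.
have lt b : (T i b - offset d i < sumn (la i))%N.
  by rewrite sumn_shape; have /andP[h1 h2] := Tblock b; rewrite ltn_subLR.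
pose t : {ffun box (la i) -> 'I_(sumn (la i))} := [ffun b => Ordinal (lt b)].
have tE b b' : (t b < t b')%N = (T i b < T i b')%N.
  rewrite !ffunE /=; have /andP[h1 _] := Tblock b; have /andP[h2 _] := Tblock b'.
  by rewrite ltn_sub2rE.
rewrite /nb_std; apply/card_gt0P; exists t; rewrite inE; apply/andP; split.
  apply/forallP => k; apply/cards1P.
  have lt_k : (offset d i + k < n)%N.
    apply: leq_trans (offset_block_le i).
    by rewrite ltn_add2l -(sumn_shape i).
  have : Ordinal lt_k \in block d i.
    by rewrite inE /= leq_addr ltn_add2l -(sumn_shape i) ltn_ord.
  case: (hT) => _ /(_ i) <- /imsetP[b _ kb]; exists b; apply/setP => b'.
  rewrite !inE ffunE -val_eqE /=; have /andP[h1 _] := Tblock b'.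
  apply/eqP/eqP => [e|->]; last by rewrite -kb /= addKn.
  have : T i b' = T i b by apply/val_inj; rewrite -kb /= -e subnKC.
  by move/(@entry_inj (to_rbox b') (to_rbox b))/eqP; rewrite eq_Tagged => /eqP.
case: hT => -[_ /(_ i)/forallP h] _; apply/forallP => b; apply/forallP => b'.
by rewrite !tE; have /forallP := h b; apply.
Qed.

End Tableau.

(** * The standard tableau filled row after row, and its indices *)

Section Windex.

Variable w : seq nat.

Lemma windex_le k l : (k <= l)%N -> (windex w k <= windex w l)%N.
Proof.
move=> kl; rewrite -(subnKC kl); elim: (l - k)%N => [|m IH]; first by rewrite addn0.
by rewrite addnS /=; case: ifP => _ //; apply: leq_trans IH _.
Qed.

Lemma windex_ascending k l : (k <= l)%N ->
    (forall m, (k <= m < l)%N -> (index m w < index m.+1 w)%N) ->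
  windex w l = windex w k.
Proof.
move=> kl; rewrite -(subnKC kl); elim: (l - k)%N => [|m IH] h; first by rewrite addn0.
rewrite addnS /= h ?leq_addr ?ltnS ?addnS ?leqnn //.
by apply: IH => j /andP[kj jl]; apply: h; rewrite kj addnS ltnW.
Qed.

Lemma windex_eq_ascending k l : (k < l)%N -> windex w k = windex w l ->
  (index k w < index l w)%N.
Proof.
move=> kl; rewrite -(subnKC kl); elim: (l - k.+1)%N => [|m IH].
  by rewrite addn0 /=; case: ifP => // _ /eqP; rewrite ltn_eqF.
rewrite addnS /=; case: ifP => [lt e|_ e].
  by apply: ltn_trans lt; apply: IH.
have : (windex w k <= windex w (k.+1 + m))%N.
  by apply: windex_le; rewrite addSn ltnW // ltnS leq_addr.
by rewrite e ltnn.
Qed.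

(** Otherwise the index never grows from k to l, so that k, ..., l occur in this
    order in the word. *)
Lemma windex_descent k l : (k < l)%N -> (index l w < index k w)%N ->
  (windex w k < windex w l)%N.
Proof.
move=> kl lk; rewrite ltn_neqAle windex_le 1?ltnW // andbT.
by apply/eqP => /(windex_eq_ascending kl); rewrite ltnNge ltnW.
Qed.

End Windex.

Section RowFilling.

Variables (r : nat) (d : 'I_r -> nat) (la : 'I_r -> seq nat).
Hypothesis hla : is_rdiagram d la.

Local Notation n := (nvars d).

Lemma sumn_takeS (s : seq nat) k : (k < size s)%N ->
  sumn (take k.+1 s) = (sumn (take k s) + nth 0 s k)%N.
Proof. by move=> ks; rewrite (take_nth 0%N) // sumn_rcons. Qed.

Lemma sumn_take_le (s : seq nat) k l : (k <= l)%N ->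
  (sumn (take k s) <= sumn (take l s))%N.
Proof.
by move=> kl; rewrite -(subnKC kl) takeD sumn_cat leq_addr.
Qed.

Definition row_filling_nat i (b : box (la i)) : nat :=
  offset d i + (sumn (take (brow b) (la i)) + bcol b).

Lemma row_filling_lt_next i (b : box (la i)) :
  (sumn (take (brow b) (la i)) + bcol b < sumn (take (brow b).+1 (la i)))%N.
Proof. by rewrite sumn_takeS ?ltn_add2l; [apply: ltn_ord | apply: ltn_ord]. Qed.

Lemma row_filling_lt_block i (b : box (la i)) :
  (row_filling_nat b < offset d i + d i)%N.
Proof.
rewrite /row_filling_nat ltn_add2l -(sumn_shape hla i).
apply: leq_trans (row_filling_lt_next b) _.
by rewrite -[X in (_ <= sumn X)%N](cat_take_drop (brow b).+1) sumn_cat leq_addr.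
Qed.

Lemma offset_le (i j : 'I_r) : (i < j)%N -> (offset d i + d i <= offset d j)%N.
Proof.
move=> ij; rewrite /offset [leqRHS](bigID (fun l : 'I_r => (l < i)%N)) /=.
apply: leq_add.
  rewrite [leqRHS](eq_bigl (fun l : 'I_r => (l < i)%N)) // => l.
  by apply/andP/idP => [[]|li] //; split=> //; apply: ltn_trans li ij.
by rewrite (bigD1 i) /= ?ij ?ltnn // leq_addr.
Qed.

Lemma row_filling_lt i (b : box (la i)) : (row_filling_nat b < n)%N.
Proof. exact: leq_trans (row_filling_lt_block b) (offset_block_le d i). Qed.

Definition row_filling : rtableau d la := fun i b => Ordinal (row_filling_lt b).

Lemma row_filling_row i (b b' : box (la i)) : (brow b < brow b')%N ->
  (row_filling_nat b < row_filling_nat b')%N.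
Proof.
move=> bb'; rewrite ltn_add2l; apply: leq_trans (row_filling_lt_next b) _.
by apply: leq_trans (leq_addr _ _); apply: sumn_take_le.
Qed.

Lemma row_filling_comp i j (b : box (la i)) (b' : box (la j)) : (i < j)%N ->
  (row_filling_nat b < row_filling_nat b')%N.
Proof.
move=> ij; apply: leq_trans (row_filling_lt_block b) _.
exact: leq_trans (offset_le ij) (leq_addr _ _).
Qed.

Lemma row_filling_inj : injective (entry row_filling).
Proof.
case=> i b [j b'] /(congr1 val) /= e.
case: (ltngtP i j) => [ij|ji|/val_inj ij].
- by have := row_filling_comp b b' ij; rewrite e ltnn.
- by have := row_filling_comp b' b ji; rewrite e ltnn.
case: j / ij b' e => b' e; congr (existT _ i _).
case: (ltngtP (brow b) (brow b')) => [bb|bb|bb].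
- by have := row_filling_row bb; rewrite e ltnn.
- by have := row_filling_row bb; rewrite e ltnn.
apply: box_eq => //; move: e; rewrite /row_filling_nat bb.
by move/addnI/addnI.
Qed.

Variable T : rtableau d la.
Hypothesis hT : is_natural T.

Lemma row_filling_standard : is_standard row_filling.
Proof.
split=> [k|i]; last first.
  apply/forallP => b; apply/forallP => b'; apply/andP; split; apply/implyP.
    case/andP => /eqP bb lt; rewrite /= ltn_add2l bb.
    by rewrite ltn_add2l.
  by case/andP => _; apply: row_filling_row.
have [g gK Kg] : bijective (entry row_filling).
  apply: (inj_card_bij row_filling_inj).
  by rewrite (bij_eq_card (Bijective (entryK hT) (box_ofK hT))).
apply/eqP/cards1P; exists (g k); apply/setP => b; rewrite !inE.
by apply/eqP/eqP => [<-|->]; rewrite ?gK ?Kg.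
Qed.

Lemma reading_leE (b b' : rbox la) : reading_le b b' =
  (let: (i, c, k) := (val (tag b), bcol (tagged b), brow (tagged b)) in
   let: (i', c', k') := (val (tag b'), bcol (tagged b'), brow (tagged b')) in
   (i < i') || (i == i') && ((c < c') || (c == c') && (k' <= k)))%N.
Proof. by rewrite /reading_le val_eqE andb_orr. Qed.

Lemma reading_le_total : total (@reading_le r la).
Proof. by move=> b b'; rewrite !reading_leE; lia. Qed.

Lemma reading_le_trans : transitive (@reading_le r la).
Proof. by move=> b a c; rewrite !reading_leE; lia. Qed.

Lemma reading_le_anti (b b' : rbox la) :
  reading_le b b' -> reading_le b' b -> b = b'.
Proof.
rewrite !reading_leE => h1 h2.
have e1 : val (tag b) = val (tag b') by lia.
have e2 : bcol (tagged b) = bcol (tagged b') by lia.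
have e3 : brow (tagged b) = brow (tagged b') by lia.
case: b b' e1 e2 e3 {h1 h2} => i b [j b'] /= /val_inj ij.
by case: j / ij b' => b' e2 e3; congr (existT _ i _); apply: box_eq.
Qed.

Lemma index_word (b b' : rbox la) : b != b' -> reading_le b b' ->
  (index (val (entry row_filling b)) (word row_filling) <
   index (val (entry row_filling b')) (word row_filling))%N.
Proof.
move=> nb le; rewrite /word; set s := sort _ _.
pose f b0 := nat_of_ord (entry row_filling b0).
have f_inj : injective f by move=> x z /val_inj /row_filling_inj.
have s_all x : x \in s by rewrite mem_sort mem_enum.
rewrite -!/(f _) -/f !(index_map f_inj) ltnNge leq_eqVlt.
apply/negP => /orP[/eqP e|lt].
  by case/eqP: nb; rewrite -(nth_index b (s_all b)) -e nth_index.
have := sorted_ltn_index reading_le_trans (sort_sorted reading_le_total _)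
  _ _ (s_all b') (s_all b) lt.
by move/(reading_le_anti le)/eqP; rewrite (negPf nb).
Qed.

(** The entries from b to b' are consecutive and are read from left to right. *)
Lemma index_tableau_row i (b b' : box (la i)) : brow b = brow b' ->
  index_tableau row_filling (to_rbox b) = index_tableau row_filling (to_rbox b').
Proof.
wlog bb' : b b' / (bcol b <= bcol b')%N.
  by move=> h e; case: (leqP (bcol b) (bcol b')) => [|/ltnW] le; [|symmetry]; apply: h.
move=> e; apply/esym/windex_ascending => [|m /andP[m1 m2]].
  by rewrite /= leq_add2l e leq_add2l.
pose c := (m - (offset d i + sumn (take (brow b) (la i))))%N.
have mE : m = (offset d i + (sumn (take (brow b) (la i)) + c))%N.
  by move: m1; rewrite /c /= /row_filling_nat; lia.
have c1 : (c < bcol b')%N.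
  by move: m2; rewrite mE /= /row_filling_nat -e !ltn_add2l.
have c2 : (c.+1 < nth 0 (la i) (tag b'))%N by apply: leq_ltn_trans (ltn_ord (tagged b')).
have c3 := ltnW c2.
pose b1 : box (la i) := Tagged (fun j : 'I__ => 'I_(nth 0 (la i) j)) (Ordinal c3).
pose b2 : box (la i) := Tagged (fun j : 'I__ => 'I_(nth 0 (la i) j)) (Ordinal c2).
have -> : m = val (entry row_filling (to_rbox b1)).
  by rewrite mE /= /row_filling_nat e.
have -> : (val (entry row_filling (to_rbox b1))).+1 =
    val (entry row_filling (to_rbox b2)).
  by rewrite /= /row_filling_nat -!addnS.
apply: index_word; last by rewrite /reading_le /= /bcol /= eqxx ltnS leqnn orbT.
apply/eqP => /(congr1 (fun b => bcol (tagged b))); rewrite /bcol /= => /eqP.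
by rewrite ltn_eqF.
Qed.

(** By [index_tableau_row] one may compare the first boxes of the two rows, and a
    column is read from bottom to top. *)
Lemma index_tableau_lt i (b b' : box (la i)) : (brow b < brow b')%N ->
  (index_tableau row_filling (to_rbox b) <
   index_tableau row_filling (to_rbox b'))%N.
Proof.
have first (b0 : box (la i)) : exists b1 : box (la i), brow b1 = brow b0 /\ bcol b1 = 0%N.
  have h : (0 < nth 0 (la i) (tag b0))%N
    by exact: leq_ltn_trans (leq0n _) (ltn_ord (tagged b0)).
  by exists (Tagged (fun j : 'I__ => 'I_(nth 0 (la i) j)) (Ordinal h)).
have [b1 [r1 c1]] := first b; have [b1' [r1' c1']] := first b'.
rewrite -(index_tableau_row r1) -(index_tableau_row r1') -r1 -r1' => lt.
apply: windex_descent; first exact: row_filling_row.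
apply: index_word; last by rewrite reading_leE /= c1 c1' !eqxx (ltnW lt) orbT.
by apply/eqP => /(congr1 (fun b => brow (tagged b))) /= e; move: lt; rewrite e ltnn.
Qed.

End RowFilling.

(** * The module of a natural standard tableau *)

Section Specht.

Variables (R : realType) (r : nat) (d : 'I_r -> nat).

Local Notation n := (nvars d).
Local Notation C := (R[i]).
Local Notation OX := {mpoly C[n]}.
Local Notation K := {fraction OX}.
Local Notation tofrac := (@FracField.tofrac OX).
Local Notation scal := (@scal R r d).
Local Notation DeltaF := ((Delta d R)%:F).

Variable y : 'I_n -> OX.
Hypothesis hy : is_coord_system y.
Variable dy : 'I_n -> K -> K.
Hypothesis hdy : forall j, extends_dy y j (dy j).
Variable la : 'I_r -> seq nat.
Hypothesis hla : is_rdiagram d la.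
Variable T : rtableau d la.
Arguments T : clear implicits.
Hypothesis hT : is_natural T.

Local Notation comp := (comp_of hT).
Local Notation row := (row_of hT).
Local Notation col := (col_of hT).
Local Notation G := (stab comp [set: 'I_n]).

(** This form lets [sact] be used where a family of morphisms is expected. *)
Definition sact_rmorphism (s : {perm 'I_n}) : {rmorphism K -> K} := @sact r d R s.
Local Notation act := sact_rmorphism.
Local Notation young_sum := (young_on comp row col act [set: 'I_n]).

Lemma tofrac_inj : injective tofrac.
Proof. by move=> p q /eqP; rewrite tofrac_eq => /eqP. Qed.

Lemma OU_clear (u : K) : OU u -> exists p m, u * DeltaF ^+ m = p%:F.
Proof.
by move=> [p [m ->]]; exists p, m; rewrite mulfVK ?DeltaF_neq0.
Qed.

Lemma block_setE i : block d i = [set k | comp k == i].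
Proof. by apply/setP => k; rewrite (block_comp hT) inE. Qed.

Lemma coord_symmetric j : block_symmetric comp (comp j) (y j).
Proof.
have [h _ _] := hy (comp j).
have [|h1 h2] := h j; first by rewrite block_setE inE.
by rewrite block_setE in h1 h2; split.
Qed.

Lemma coord_generate i (p : OX) : block_symmetric comp i p ->
  exists q, p = q \mPo [tuple y j | j < n].
Proof.
have [_ h _] := hy i; move=> [p1 p2].
have [|q _ ->] := h p; last by exists q.
by split; rewrite block_setE.
Qed.

Lemma dy_OU j u : OU u -> OU (dy j u).
Proof. by case: (hdy j) => h _ _ _; apply: h. Qed.

Lemma dyD j u v : OU u -> OU v -> dy j (u + v) = dy j u + dy j v.
Proof. by case: (hdy j) => _ h _ _; apply: h. Qed.

Lemma dyM j u v : OU u -> OU v -> dy j (u * v) = dy j u * v + u * dy j v.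
Proof. by case: (hdy j) => _ _ h _; apply: h. Qed.

Lemma dy_coord j (q : OX) : dy j (sy y q)%:F = (sy y q^`M(j))%:F.
Proof. by case: (hdy j) => _ _ _ h; apply: h. Qed.

Local Notation DVy := (DV y dy).

Lemma dy_scalE j c : dy j (scal c) = 0.
Proof. exact: (dy_scalar dy_coord). Qed.

Lemma DV_OU P u : DVy P -> OU u -> OU (P u).
Proof.
move=> hP; elim: hP u => [c|j|j||P1 P2 _ h1 _ h2|P1 P2 _ h1 _ h2] u hu.
- by apply: OUM => //; apply: OU_poly.
- by apply: OUM => //; apply: OU_poly.
- exact: dy_OU.
- by apply: OUM => //; apply: OU_invDelta.
- by apply: OUD; [apply: h1 | apply: h2].
- by apply: h1; apply: h2.
Qed.

Lemma DVD P u v : DVy P -> OU u -> OU v -> P (u + v) = P u + P v.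
Proof.
move=> hP; elim: hP u v => [c|j|j||P1 P2 _ h1 _ h2|P1 P2 _ h1 hP2 h2] u v hu hv.
- exact: mulrDr.
- exact: mulrDr.
- exact: dyD.
- exact: mulrDr.
- by rewrite h1 // h2 // addrACA.
- by rewrite h2 // h1 //; apply: DV_OU.
Qed.

Lemma act_sactM (s t : {perm 'I_n}) u : act (s * t)%g u = act t (act s u).
Proof. exact: sactM. Qed.

Lemma act_sact1 u : act 1%g u = u.
Proof. exact: sact1. Qed.

Lemma act_sact_poly s p : act s p%:F = (msym s p)%:F.
Proof. exact: sact_poly. Qed.

Lemma act_sact_scal s c : act s (scal c) = scal c.
Proof. exact: sact_scal. Qed.

Lemma act_OU s u : s \in G -> OU u -> OU (act s u).
Proof. exact: OU_sact (block_comp hT) s u. Qed.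

Lemma DV_sact P s u : DVy P -> s \in G -> OU u -> P (act s u) = act s (P u).
Proof.
move=> hP sG; elim: hP u => [c|j|j||P1 P2 _ h1 _ h2|P1 P2 _ h1 hP2 h2] u hu.
- by rewrite rmorphM -[_%:F]/(scal c) act_sact_scal.
- by rewrite rmorphM act_sact_poly (block_symmetricG (coord_symmetric j) sG).
- exact: (dy_act coord_symmetric coord_generate tofrac_inj (Delta_neq0 R d)
    (@OU_poly R r d) OU_clear act_sactM act_sact1 act_sact_poly act_OU
    dyD dyM dy_coord).
- rewrite rmorphM fmorphV -(rmorphXn tofrac) act_sact_poly.
  by rewrite (Delta2_inv R (block_comp hT) sG).
- by rewrite rmorphD h1 // h2.
- by rewrite h2 // h1 //; apply: DV_OU.
Qed.

Lemma DV_mul_invariant (a : K) : OU a -> (forall s, s \in G -> act s a = a) ->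
  exists2 P, DVy P & forall u, OU u -> P u = a * u.
Proof.
apply: (DV_invariant coord_symmetric coord_generate tofrac_inj (Delta_neq0 R d)
  OU_clear act_sact_poly (@DV_scalar _ _ _ y dy) (@DV_y _ _ _ y dy)
  (DV_invDelta2 y dy) (@DV_add _ _ _ y dy) (@DV_mul _ _ _ y dy)).
by move=> s sG; rewrite (Delta2_inv R (block_comp hT) sG).
Qed.

Local Notation young_space := (young_image (@OU r d R) comp row col act).

Lemma dy_constant u : OU u -> (forall j, dy j u = 0) -> exists c, u = scal c.
Proof.
exact: (dy_const coord_generate tofrac_inj (Delta_neq0 R d) (@OU_poly R r d)
  OU_clear dyD dyM dy_coord).
Qed.

Lemma DU_unit_OU u : OU u -> u != 0 ->
  exists2 S, DU (@OU r d R) dy S & S u = 1.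
Proof.
exact: (DU_unit coord_generate tofrac_inj (Delta_neq0 R d) (@OU_poly R r d)
  OU_clear dyD dyM dy_coord).
Qed.

Lemma DV_id : exists2 P, DVy P & forall u, OU u -> P u = u.
Proof.
exists (fun u => scal 1 * u); first exact: DV_scalar.
by move=> u _; rewrite rmorph1 mul1r.
Qed.

Lemma young_space_simple (N : K -> Prop) :
    (forall P u, DVy P -> N u -> N (P u)) -> (forall u, N u -> young_space u) ->
    (exists2 v, N v & v != 0) ->
  forall u, young_space u -> N u.
Proof.
exact: (young_image_simple (@OU_scal R r d) (@OUD R r d) (@OUM R r d)
  DV_OU DVD (@DV_mul _ _ _ y dy) (@DV_add _ _ _ y dy) (@DV_dy _ _ _ y dy)
  dyM dy_scalE dy_constant DU_unit_OU DV_id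
  (@box_of_inj _ _ _ _ hT) (@box_of_closed _ _ _ hla _ hT)
  act_sactM act_sact1 act_sact_scal act_OU DV_sact DV_mul_invariant).
Qed.

Definition young_const i : C := (nb_std (la i))%:R / (sumn (la i))`!%:R.

Lemma young_const_neq0 i : young_const i != 0.
Proof.
rewrite mulf_neq0 ?invr_eq0 ?pnatr_eq0 -?lt0n ?fact_gt0 //.
exact: (nb_std_gt0 hla hT).
Qed.

Lemma young_on_scal B c u :
  young_on comp row col act B (scal c * u) = scal c * young_on comp row col act B u.
Proof.
by apply: young_onZ => s; apply: act_sact_scal.
Qed.

Lemma young1E i u : young1 (T i) u =
  scal (young_const i) * young_on comp row col act [set k | comp k == i] u.
Proof. by rewrite /young1 (row_stabE hT) (col_stabE hT). Qed.

(** Composing the symmetrizers of the blocks gives the one of the whole tableau,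
    and their normalizing factors do not vanish. *)
Lemma youngE : exists2 c, c != 0 &
  forall u : K, young T u = scal c * young_sum u.
Proof.
exists (\prod_(i <- enum 'I_r) young_const i).
  by rewrite prodf_seq_neq0; apply/allP => i _ /=; apply: young_const_neq0.
move=> u; have act_c g i : act g (scal (young_const i)) = scal (young_const i).
  exact: act_sact_scal.
have := foldr_young_on act_sactM u act_sact1 act_c young1E (enum_uniq 'I_r).
rewrite /young => ->; rewrite (rmorph_prod scal) (_ : [set k | _] = [set: 'I_n]) //.
by apply/setP => k; rewrite !inE mem_enum.
Qed.

Lemma image_youngE v : image_young R T v <-> young_space v.
Proof.
have [c c0 e] := youngE.
have c'c u : scal c * (scal c^-1 * u) = u.
  by rewrite mulrA -rmorphM divff // rmorph1 mul1r.
split=> [] [u hu ->].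
  exists (scal c * u); first by apply: OUM => //; apply: OU_scal.
  by rewrite young_on_scal; apply: e.
exists (scal c^-1 * u); first by apply: OUM => //; apply: OU_scal.
rewrite (e (scal c^-1 * u)) -young_on_scal.
by apply: congr1; rewrite c'c.
Qed.

Lemma young_space_submodule : is_submodule y dy young_space.
Proof.
split=> [_ [u hu ->]||_ _ [u hu ->] [v hv ->]|P _ hP [u hu ->]].
- exact: (young_op_OU (@OU_scal R r d) (@OUD R r d) (@OUM R r d) row col act_OU hu).
- exists 0; first exact: OU0.
  by apply: (addrI (young_sum 0)); rewrite -young_onD !addr0.
- by exists (u + v); [apply: OUD | rewrite young_onD].
- exists (P u); first exact: DV_OU.
  exact: (DV_young_op (@OU_scal R r d) (@OUD R r d) (@OUM R r d) DVD row col
    act_OU DV_sact hP hu).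
Qed.

(** Transported to the entries of T, the indices of the row filling are constant
    on rows and distinguish the rows of a component, as [young_monomial_neq0]
    asks. *)
Lemma higher_specht_neq0 : higher_specht R T (row_filling hla) != 0.
Proof.
have [c c0 e] := youngE; rewrite /higher_specht e mulf_neq0 //.
  by rewrite fmorph_eq0.
pose w k := index_tableau (row_filling hla) (box_of hT k).
have -> : index_monomial R T (row_filling hla) = 'X_[ [multinom w k | k < n] ].
  rewrite mpolyXE_id /index_monomial (reindex (box_of hT)) /=; last first.
    by apply: onW_bij; exists (entry T); [apply: box_ofK | apply: entryK].
  by apply: eq_bigr => k _; rewrite mnmE box_ofK.
have wE i (b : box (la i)) : w (T i b) = index_tableau (row_filling hla) (to_rbox b).
  by rewrite /w -[T i b]/(entry T (to_rbox b)) entryK.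
pose p : OX := \sum_(s in stab (fun k => (comp k, row k)) [set: 'I_n])
    \sum_(t in stab (fun k => (comp k, col k)) [set: 'I_n])
      (-1) ^+ odd_perm t * msym t (msym s 'X_[ [multinom w k | k < n] ]).
have -> : young_sum ('X_[ [multinom w k | k < n] ])%:F = p%:F.
  rewrite /p /young_on rmorph_sum; apply: eq_bigr => s _.
  rewrite rmorph_sum; apply: eq_bigr => t _.
  by rewrite !act_sact_poly (rmorphM tofrac) (rmorph_sign tofrac).
rewrite tofrac_eq0 /p; apply: young_monomial_neq0; first exact: box_of_inj.
- move=> k l; have [b ->] := entry_of hT k; have [b' ->] := entry_of hT l.
  move: (comp k) (comp l) b b' => i j b b'.
  rewrite !comp_entry => ij; case: j / ij b' => b'.
  by rewrite !row_entry !wE; apply: index_tableau_row.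
- move=> k l; have [b ->] := entry_of hT k; have [b' ->] := entry_of hT l.
  move: (comp k) (comp l) b b' => i j b b'.
  rewrite !comp_entry => ij; case: j / ij b' => b'.
  rewrite !row_entry !wE => eb; case: (ltngtP (brow b) (brow b')) => // lt.
    by have := index_tableau_lt hla lt; rewrite eb ltnn.
  by have := index_tableau_lt hla lt; rewrite eb ltnn.
Qed.

End Specht.

Theorem theorem3p5 (R : realType) (r : nat) (hr : (0 < r)%N)
    (d : 'I_r -> nat) (hd : forall i, (0 < d i)%N)
    (y : 'I_(nvars d) -> {mpoly R[i][nvars d]})
    (hy : is_coord_system y)
    (dy : 'I_(nvars d) -> {fraction {mpoly R[i][nvars d]}} ->
          {fraction {mpoly R[i][nvars d]}})
    (hdy : forall j, extends_dy y j (dy j))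
    (la : 'I_r -> seq nat) (hla : is_rdiagram d la)
    (T : rtableau d la) (hT : is_natural T) :
  (is_submodule y dy (image_young R T) /\ nonzero (image_young R T)) /\
  is_simple y dy (image_young R T) /\
  (exists2 S : rtableau d la, is_standard S &
     forall u, image_young R T u <-> cyclic_submodule y dy (higher_specht R T S) u).
Proof.
pose S := row_filling hla; have imE v := image_youngE hla hT v.
have sub : is_submodule y dy (image_young R T).
  have [h1 h2 h3 h4] := young_space_submodule hy hdy hT.
  split=> [u /imE /h1 //||u v /imE hu /imE hv|P u hP /imE hu].
  - exact/imE.
  - by apply/imE; apply: h3.
  - by apply/imE; apply: h4.
have MF : image_young R T (higher_specht R T S).
  by exists (index_monomial R T S)%:F => //; apply: OU_poly.
have F0 : higher_specht R T S != 0 := higher_specht_neq0 R hla hT.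
have simple (N : {fraction {mpoly R[i][nvars d]}} -> Prop) :
    (forall P u, DV y dy P -> N u -> N (P u)) ->
    (forall u, N u -> image_young R T u) -> (exists2 v, N v & v != 0) ->
    forall u, image_young R T u -> N u.
  move=> NDV NM N0 u /imE; apply: (young_space_simple hy hdy hla) => //.
  by move=> v /NM /imE.
have nz : nonzero (image_young R T) by exists (higher_specht R T S).
split=> //; split.
  split=> // N [_ N0 _ NDV] NM.
  have [[v Nv v0]|h] := boolp.EM (exists2 v, N v & v != 0).
    right=> u; split; first exact: NM.
    by apply: simple => //; exists v.
  left=> u Nu; apply/eqP; apply: contraT => u0; case: h; by exists u.
exists S; first exact: row_filling_standard hT.
move=> u; split; last by case=> P hP ->; case: sub => _ _ _; apply.
apply: (simple (cyclic_submodule y dy (higher_specht R T S))).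
- by move=> P _ hP [Q hQ ->]; exists (fun w => P (Q w)) => //; apply: DV_mul.
- by move=> _ [P hP ->]; case: sub => _ _ _; apply.
- exists (higher_specht R T S) => //.
  exists (fun w => (1%:MP)%:F * w); first exact: DV_scalar.
  by rewrite mpolyC1 rmorph1 mul1r.
Qed.
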